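(* Let $\Omega\subset\mathbb{R}^2$, let $\mathbf{x}_S\in\Omega$ be a fixed starting point, and let $s_{max}>0$. Let $n\ge 1$, let $\mathbf{v}_{c,1},\dots,\mathbf{v}_{c,n}:\Omega\times[0,T_f]\to\mathbb{R}^2$ be velocity fields with $\max_{\mathbf{x},t}|\mathbf{v}_{c,i}(\mathbf{x},t)|<s_{max}$ for $i=1,\dots,n$, and let $p(1),\dots,p(n)\in[0,1]$ with $\sum_{i=1}^n p(i)=1$. Let $s_{i,max}$, $\mathbf{e}_\theta$, the travel times $T_i(\mathbf{x},\mathbf{x}_S,\gamma)$, the minimal mean reachability time $u(\mathbf{x},\mathbf{x}_S)$ and the minimizing path $\gamma^*$ be as defined in the context. Assume that, as functions of $\mathbf{x}$, $u(\mathbf{x},\mathbf{x}_S)$ and $T_i(\mathbf{x},\mathbf{x}_S,\gamma^* )$, $i=1,\dots,n$, are continuous on $\Omega$ and smooth away from $\mathbf{x}_S$. Then $u=u(\mathbf{x},\mathbf{x}_S)$, together with $T_i=T_i(\mathbf{x},\mathbf{x}_S,\gamma^* )$, satisfies the following system of Hamilton-Jacobi partial differential equations for $\mathbf{x}\in\Omega$, $\mathbf{x}\neq\mathbf{x}_S$ (gradients are taken with respect to $\mathbf{x}$): $$\min_{\theta\in[0,2\pi)}\Big\{-\nabla u\cdot s_{1,max}(\theta,\mathbf{x},T_1)\,\mathbf{e}_\theta+\sum_{i=1}^n p(i)\,\frac{s_{1,max}(\theta,\mathbf{x},T_1)}{s_{i,max}(\theta,\mathbf{x},T_i)}\Big\}=0,$$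 $$\nabla T_i(\mathbf{x},\mathbf{x}_S,\gamma^* )\cdot s_{i,max}(\theta^*,\mathbf{x},T_i)\,\mathbf{e}_{\theta^*}=1,\qquad i=1,\dots,n,$$ subject to the boundary conditions $$u(\mathbf{x}_S,\mathbf{x}_S)=0,\qquad T_i(\mathbf{x}_S,\mathbf{x}_S,\gamma^* )=0,\qquad i=1,\dots,n,$$ where $\theta^*=\theta^*(\mathbf{x})$ denotes the minimizer $\theta$ in the first equation at the point $\mathbf{x}$.
   Context: A vehicle moves in $\Omega\subset\mathbb{R}^2$. Under the $i$-th current model its position satisfies $\frac{d\mathbf{y}_i}{dt}=\mathbf{v}_w(t)+\mathbf{v}_{c,i}(\mathbf{y}_i,t)$, $\mathbf{y}_i(0)=\mathbf{x}_S$, where the propulsion velocity $\mathbf{v}_w$ satisfies $|\mathbf{v}_w(t)|\le s_{max}$. The number $p(i)$ is the probability that the $i$-th current model is realized. For $\theta\in[0,2\pi)$ let $\mathbf{e}_\theta=[\cos\theta,\sin\theta]^\top$ and let $\mathbf{e}_\theta^\perp$ be a unit vector perpendicular to $\mathbf{e}_\theta$. The maximum ground speed of the vehicle in direction $\theta$ at position $\mathbf{x}$ and time $t$ under the $i$-th model is $$s_{i,max}(\theta,\mathbf{x},t)=\mathbf{v}_{c,i}(\mathbf{x},t)\cdot\mathbf{e}_\theta+\sqrt{s_{max}^2-\big(\mathbf{v}_{c,i}(\mathbf{x},t)\cdot\mathbf{e}_\theta^\perp\big)^2},$$ which is assumed positive (this follows from $|\mathbf{v}_{c,i}|<s_{max}$).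 In the claim, $s_{i,max}(\theta,\mathbf{x},T_i)$ means this quantity evaluated at time $t=T_i(\mathbf{x},\mathbf{x}_S,\gamma^* )$. For a (geometric) curve $\gamma$ in $\Omega$ connecting $\mathbf{x}_S$ to $\mathbf{x}$, $T_i(\mathbf{x},\mathbf{x}_S,\gamma)$ is the time the vehicle requires to travel from $\mathbf{x}_S$ (starting at time $0$) to $\mathbf{x}$ along $\gamma$ under the $i$-th current model, i.e. the arrival time at $\mathbf{x}$ of the motion $\frac{d\mathbf{y}_i}{dt}=s_{i,max}(\theta,\mathbf{y}_i,t)\,\mathbf{e}_\theta$, $\mathbf{y}_i(0)=\mathbf{x}_S$, where $\mathbf{e}_\theta$ is the unit direction of travel of $\gamma$ at $\mathbf{y}_i(t)$. The mean reachability time along $\gamma$ is $$\bar T(\mathbf{x},\mathbf{x}_S,\gamma)=\sum_{i=1}^n p(i)\,T_i(\mathbf{x},\mathbf{x}_S,\gamma),$$ and the minimal mean reachability time is $$u(\mathbf{x},\mathbf{x}_S)=\min_\gamma\bar T(\mathbf{x},\mathbf{x}_S,\gamma),$$ the minimum being over curves $\gamma$ in $\Omega$ connecting $\mathbf{x}_S$ to $\mathbf{x}$; the minimum is assumed to be attained, and $\gamma^*$ (depending on $\mathbf{x}$) denotes a minimizing path. All $n$ models use the same geometric path $\gamma^*$. Here $T_f$ is the length of the prescribed time interval $[0,T_f]$ on which the currents are defined, understood to contain all travel times involved.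
   Formalization: The second equation is proved only at x where T_i at each point of γ* (for x) equals the time the vehicle following γ* passes that point; it can fail otherwise for n≥2 and time-dependent currents. The currents are taken continuous, and the equations hold at interior points of Ω. *)

(* Defs.v *)
From HB Require Import structures.
From mathcomp Require Import all_boot all_order all_algebra.
From mathcomp Require Import all_classical all_reals all_analysis.
Set Implicit Arguments.
Unset Strict Implicit.
Unset Printing Implicit Defensive.
Import Order.TTheory GRing.Theory Num.Theory numFieldNormedType.Exports.
Local Open Scope classical_set_scope.
Local Open Scope ring_scope.

Section Plane.
Context {R : realType}.

Definition vec2 (a b : R) : 'rV[R]_2 := \row_j (if j == 0 then a else b).

Definition dot (a b : 'rV[R]_2) : R := \sum_j a 0 j * b 0 j.

(* The library norm on matrices is the max norm, hence this definition. *)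
Definition enorm (a : 'rV[R]_2) : R := Num.sqrt (dot a a).

Definition e_ (theta : R) : 'rV[R]_2 := vec2 (cos theta) (sin theta).
Definition eperp (theta : R) : 'rV[R]_2 := vec2 (- sin theta) (cos theta).

Definition grad (f : 'rV[R]_2 -> R) (x : 'rV[R]_2) : 'rV[R]_2 :=
  \row_j 'D_(delta_mx 0 j) f x.

(* Meant for an open set D. *)
Fixpoint Ck_on (k : nat) (D : set 'rV[R]_2) (f : 'rV[R]_2 -> R) : Prop :=
  match k with
  | 0%N => forall x, D x -> {for x, continuous f}
  | k'.+1 => (forall x, D x -> differentiable f x) /\
             (forall v, Ck_on k' D ('D_v f))
  end.

Definition smooth_on (D : set 'rV[R]_2) (f : 'rV[R]_2 -> R) : Prop :=
  forall k, Ck_on k D f.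

Definition is_min (A : set R) (m : R) : Prop := A m /\ lbound A m.

Definition is_minimizer (D : set R) (f : R -> R) (a : R) : Prop :=
  D a /\ forall b, D b -> f a <= f b.

(* An oriented geometric curve, represented by its arc-length parametrization
   on [0, clen]; the values of cpath outside [0, clen] are irrelevant. *)
Record curve := Curve { clen : R; cpath : R -> 'rV[R]_2 }.

Definition C1 (g : R -> 'rV[R]_2) : Prop :=
  (forall s, derivable g s 1) /\ continuous (derive1 g).

(* Every closed piece is the restriction of a C^1 map of the line, so the
   one-sided derivatives exist at the breakpoints b k.  The case m = 0 is the
   curve reduced to a point. *)
Definition piecewise_C1_arclength (c : curve) : Prop :=
  exists (m : nat) (b : nat -> R),
    [/\ b 0%N = 0, b m = clen c,
        forall k, (k < m)%N -> b k < b k.+1 &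
        forall k, (k < m)%N -> exists g : R -> 'rV[R]_2, C1 g /\
          forall s, b k <= s <= b k.+1 ->
            cpath c s = g s /\ enorm (derive1 g s) = 1].

Definition connects (Om : set 'rV[R]_2) (xS x : 'rV[R]_2) (c : curve) : Prop :=
  [/\ piecewise_C1_arclength c, cpath c 0 = xS, cpath c (clen c) = x &
      forall s, 0 <= s <= clen c -> Om (cpath c s)].

Definition s_max (smax : R) (v : 'rV[R]_2 -> R -> 'rV[R]_2)
    (theta : R) (x : 'rV[R]_2) (t : R) : R :=
  dot (v x t) (e_ theta)
  + Num.sqrt (smax ^+ 2 - (dot (v x t) (eperp theta)) ^+ 2).

(* y t = cpath c (sigma t) is the motion along c under the current v, started
   at time 0 and arriving at the end of c at time T: dy/dt = s_max e_theta
   with e_theta the direction of c at y t, except at the finitely many times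
   E (corners of c, where there is no direction of travel). *)
Definition motion (smax Tf : R) (v : 'rV[R]_2 -> R -> 'rV[R]_2)
    (c : curve) (T : R) (sigma : R -> R) : Prop :=
  let y := fun t : R => cpath c (sigma t) in
  [/\ 0 <= T <= Tf,
      sigma 0 = 0 /\ sigma T = clen c,
      {within `[0, T], continuous sigma},
      {in `[0, T] &, {homo sigma : t1 t2 / t1 <= t2}} &
      exists E : seq R, forall t, 0 < t < T -> t \notin E ->
        exists theta : R,
          is_derive (sigma t) 1 (cpath c) (e_ theta) /\
          is_derive t 1 y (s_max smax v theta (y t) t *: e_ theta)].

(* A relation rather than a function of c: the arrival time is unique as soon
   as v is, e.g., Lipschitz in time, but this is nowhere required. *)
Definition travel_time (smax Tf : R) (v : 'rV[R]_2 -> R -> 'rV[R]_2)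
    (c : curve) (T : R) : Prop :=
  exists sigma, motion smax Tf v c T sigma.

Section Models.
Variables (Om : set 'rV[R]_2) (xS : 'rV[R]_2) (smax Tf : R).
Variables (n : nat) (vc : 'I_n -> 'rV[R]_2 -> R -> 'rV[R]_2) (p : 'I_n -> R).

(* tau lists the travel times along c under the n models. *)
Definition travel_times (c : curve) (tau : 'I_n -> R) : Prop :=
  forall i, travel_time smax Tf (vc i) c (tau i).

Definition mean_time (tau : 'I_n -> R) : R := \sum_i p i * tau i.

Definition mean_reach_times (x : 'rV[R]_2) : set R :=
  [set m | exists c tau,
     [/\ connects Om xS x c, travel_times c tau & m = mean_time tau]].

(* u x is the minimal mean reachability time, attained along the curve
   gstar x, and T i x is the travel time along gstar x under model i. *)
Definition minimal_mean_reachability (u : 'rV[R]_2 -> R)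
    (gstar : 'rV[R]_2 -> curve) (T : 'I_n -> 'rV[R]_2 -> R) : Prop :=
  forall x, Om x ->
    [/\ is_min (mean_reach_times x) (u x),
        connects Om xS x (gstar x),
        travel_times (gstar x) (T ^~ x) &
        u x = mean_time (T ^~ x)].

(* T i y is the travel time along gstar y, which need not be an initial portion
   of gstar x when y lies on gstar x: since the currents depend on time, the
   portion of gstar x up to y need not be optimal for y if n > 1.  Here, at
   each point y passed on the way along gstar x, T i y is required to be the
   time at which the vehicle following gstar x passes y. *)
Definition times_agree_along (gstar : 'rV[R]_2 -> curve)
    (T : 'I_n -> 'rV[R]_2 -> R) (x : 'rV[R]_2) : Prop :=
  forall i, exists sigma, motion smax Tf (vc i) (gstar x) (T i x) sigma /\
    forall t, 0 <= t <= T i x -> T i (cpath (gstar x) (sigma t)) = t.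

End Models.

(* The expression minimized over theta; model 1 is ord0. *)
Definition hamiltonian (smax : R) (n : nat)
    (vc : 'I_n.+1 -> 'rV[R]_2 -> R -> 'rV[R]_2) (p : 'I_n.+1 -> R)
    (u : 'rV[R]_2 -> R) (T : 'I_n.+1 -> 'rV[R]_2 -> R)
    (x : 'rV[R]_2) (theta : R) : R :=
  let s i := s_max smax (vc i) theta x (T i x) in
  - dot (grad u x) (s ord0 *: e_ theta) + \sum_i p i * (s ord0 / s i).

End Plane.

Arguments curve R : clear implicits.

(* Main.v *)
Require Import Defs.
From HB Require Import structures.
From mathcomp Require Import all_boot all_order all_algebra.
From mathcomp Require Import all_classical all_reals all_analysis.
From mathcomp Require Import ring lra.
Set Implicit Arguments.
Unset Strict Implicit.
Unset Printing Implicit Defensive.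
Import Order.TTheory GRing.Theory Num.Theory numFieldNormedType.Exports.
Local Open Scope classical_set_scope.
Local Open Scope ring_scope.

(* Dividing the Hamiltonian by s_1 > 0, the first equation says that
   grad u . e <= S e := sum_i p_i / s_i(e) for every unit vector e, with
   equality for some e.
   Upper bound: follow gamma*(x), then a short segment in direction e. The
   travel times along the segment solve a scalar ODE whose right-hand side is
   only continuous, so Peano's theorem is needed.
   Equality: let e be the final direction of gamma*(x). The point at arc length
   h before x is reached by a truncation of gamma*(x) at the times
   T_i - h / s_i(e) + o(h), which gives grad u . e >= S e.
   Since 1 / s_i is the gauge of a disc, S is strictly convex, so the equality
   holds for a single e, and theta* is the final direction of gamma*(x); the
   second equation is then the derivative of T_i along gamma*(x) at x. *)

(** * Ground speed *)

(** A curve may have several travel times, and both bounds tolerate this: for the upper one any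
    solution of the equation on the segment will do, since [u] is a minimum over all travel times,
    and for the lower one [arrival_rate] holds for every motion. The modified curve is only a
    competitor for [u] at a nearby point, whose own minimizer is never examined. For the second
    equation this is not enough: T_i near x is measured along other minimizers, and
    [times_agree_along] ties it to the passing times of gamma*(x). A motion provides a derivative of
    the position, not of [sigma], and only off finitely many times; hence scalar mean value
    estimates for the position projected on the final direction. Continuity of the currents is
    usable at (x, T_i) because x is interior and 0 < T_i < Tf; [T_lt] also leaves time for the added
    segment. *)

Section PlaneVectors.
Context {R : realType}.
Implicit Types (a b e w : 'rV[R]_2) (smax : R).

Lemma dot2 a b : dot a b = a 0 0 * b 0 0 + a 0 1 * b 0 1.
Proof.
rewrite /dot !big_ord_recl big_ord0 addr0.
by congr (_ + a 0 _ * b 0 _); apply/val_inj.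
Qed.

Lemma rV2P a b : a 0 0 = b 0 0 -> a 0 1 = b 0 1 -> a = b.
Proof.
move=> h0 h1; apply/rowP; case=> [[|[|//]]] hj.
- by rewrite (_ : Ordinal hj = 0) //; apply/val_inj.
- by rewrite (_ : Ordinal hj = 1) //; apply/val_inj.
Qed.

Lemma vec20 (c d : R) : vec2 c d 0 0 = c. Proof. by rewrite mxE. Qed.
Lemma vec21 (c d : R) : vec2 c d 0 1 = d. Proof. by rewrite mxE. Qed.

Lemma dotDr a b e : dot a (b + e) = dot a b + dot a e.
Proof. by rewrite !dot2 !mxE; ring. Qed.

Lemma dotBl a b e : dot (a - b) e = dot a e - dot b e.
Proof. by rewrite !dot2 !mxE; ring. Qed.

Lemma dotZr (k : R) a b : dot a (k *: b) = k * dot a b.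
Proof. by rewrite !dot2 !mxE; ring. Qed.

Lemma dotZl (k : R) a b : dot (k *: a) b = k * dot a b.
Proof. by rewrite !dot2 !mxE; ring. Qed.

Lemma dot_ge0 a : 0 <= dot a a.
Proof. by rewrite dot2 -!expr2 addr_ge0 ?sqr_ge0. Qed.

Lemma dot_eq0 a : dot a a = 0 -> a = 0.
Proof.
rewrite dot2 => h; apply: rV2P; rewrite mxE; nra.
Qed.

Lemma normr_coord a j : `|a 0 j| <= `|a|.
Proof.
by rewrite [leRHS]/Num.Def.normr /= mx_normrE; exact: (le_bigmax _ _ (0, j)).
Qed.

Lemma normr_rV2 a (k : R) : 0 <= k -> (`|a| <= k) = (`|a 0 0| <= k) && (`|a 0 1| <= k).
Proof.
move=> k0; apply/idP/andP => [h|[h0 h1]].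
  by split; apply: le_trans h; exact: normr_coord.
rewrite [leLHS]/Num.Def.normr /= mx_normrE bigmax_le // => -[i j] _ /=.
rewrite (ord1 i); case: j => [[|[|//]]] hj.
- by rewrite (_ : Ordinal hj = 0) //; apply/val_inj.
- by rewrite (_ : Ordinal hj = 1) //; apply/val_inj.
Qed.

(** The norm is the max norm, so each of the two products is at most [|a| * |b|]; hence the factor
    2. *)
Lemma dot_le a b : `|dot a b| <= 2 * `|a| * `|b|.
Proof.
rewrite dot2; apply: (le_trans (ler_normD _ _)); rewrite !normrM.
have := ler_pM (normr_ge0 _) (normr_ge0 _) (normr_coord a 0) (normr_coord b 0).
have := ler_pM (normr_ge0 _) (normr_ge0 _) (normr_coord a 1) (normr_coord b 1).
move=> *; lra.
Qed.

Lemma norm_unit e : dot e e = 1 -> `|e| <= 1.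
Proof.
rewrite dot2 => h; rewrite normr_rV2 // !ler_norml; apply/andP; split;
  apply/andP; split; nra.
Qed.

Lemma e_unit (th : R) : dot (e_ th) (e_ th) = 1.
Proof. by rewrite dot2 !(vec20, vec21) -!expr2 cos2Dsin2. Qed.

Lemma unit_e e : dot e e = 1 -> exists2 th : R, th \in `[0, 2 * pi[ & e = e_ th.
Proof.
rewrite dot2 => h.
have ha : -1 <= e 0 0 <= 1 by apply/andP; split; nra.
have hs : Num.sqrt (1 - e 0 0 ^+ 2) = `|e 0 1|.
  by rewrite (_ : 1 - _ = (e 0 1) ^+ 2) ?sqrtr_sqr //; rewrite expr2; lra.
have pi0 := pi_gt0 R.
(* [acos] reaches the closed upper half circle. Below it the angle is reflected; it stays under
   [2 * pi] because a negative second coordinate forces the first below 1. *)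
have [b0|b0] := leP 0 (e 0 1).
  exists (acos (e 0 0)).
    by rewrite in_itv /= acos_ge0 //= (le_lt_trans (acos_lepi _)) //; lra.
  apply: rV2P; rewrite ?vec20 ?vec21 ?acosK //.
  by rewrite sin_acos // hs ger0_norm.
exists (2 * pi - acos (e 0 0)).
  have a0 : 0 < acos (e 0 0) by apply: acos_gt0; rewrite (andP ha).1 /=; nra.
  have := acos_lepi ha; rewrite in_itv /=; move=> *; apply/andP; split; lra.
have -> : 2 * pi - acos (e 0 0) = - acos (e 0 0) + pi *+ 2 :> R by rewrite -mulr_natl; lra.
apply: rV2P; rewrite ?vec20 ?vec21 ?cosD2pi ?sinD2pi ?cosN ?sinN ?acosK //.
by rewrite sin_acos // hs ltr0_norm // opprK.
Qed.

Definition perp a : 'rV[R]_2 := vec2 (- a 0 1) (a 0 0).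

(** [s_max] with the direction as a vector: continuity, convexity and uniqueness then concern unit
    vectors, and [s_maxE] and [unit_e] translate from and to angles. *)
Definition speed smax w e : R :=
  dot w e + Num.sqrt (smax ^+ 2 - dot w (perp e) ^+ 2).

Lemma s_maxE smax (v : 'rV[R]_2 -> R -> 'rV[R]_2) th x t :
  s_max smax v th x t = speed smax (v x t) (e_ th).
Proof.
rewrite /s_max /speed; congr (_ + Num.sqrt (_ - dot _ _ ^+ 2)).
by apply: rV2P; rewrite !(vec20, vec21).
Qed.

Lemma enorm_lt smax w : 0 < smax -> enorm w < smax -> dot w w < smax ^+ 2.
Proof.
move=> s0 h; rewrite -(sqr_sqrtr (dot_ge0 w)) ltr_pXn2r // nnegrE ?sqrtr_ge0 //.
exact: ltW.
Qed.

Lemma dot_perp w e : dot e e = 1 -> dot w e ^+ 2 + dot w (perp e) ^+ 2 = dot w w.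
Proof.
move=> h; rewrite -[RHS]mulr1 -h !dot2 !(vec20, vec21); ring.
Qed.

(** By [dot_perp] the radicand exceeds the square of [dot w e] by smax^2 - |w|^2 > 0, so the root
    outweighs a current pushing backwards. *)
Lemma speed_gt0 smax w e : dot w w < smax ^+ 2 -> dot e e = 1 -> 0 < speed smax w e.
Proof.
move=> hw he; have h := dot_perp w he; rewrite /speed.
have h2 := sqr_ge0 (dot w e).
have : `|dot w e| < Num.sqrt (smax ^+ 2 - dot w (perp e) ^+ 2).
  by rewrite -sqrtr_sqr ltr_sqrt; lra.
by rewrite ltr_norml => /andP[+ _]; lra.
Qed.

(* [speed smax w e] is where the ray of direction [e] leaves the disc of
   radius [smax] centred at [w]. *)
Lemma speed_on_circle smax w e : dot w w < smax ^+ 2 -> dot e e = 1 ->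
  dot (speed smax w e *: e - w) (speed smax w e *: e - w) = smax ^+ 2.
Proof.
move=> hw he; have h := dot_perp w he.
have hq : 0 <= smax ^+ 2 - dot w (perp e) ^+ 2 by have := sqr_ge0 (dot w e); lra.
have -> : dot (speed smax w e *: e - w) (speed smax w e *: e - w) =
   speed smax w e ^+ 2 * dot e e - 2 * speed smax w e * dot w e + dot w w.
  by rewrite !dot2 !mxE; ring.
rewrite he -h /speed.
have := sqr_sqrtr hq; set q := Num.sqrt _ => hq2.
have -> : smax ^+ 2 = q ^+ 2 + dot w (perp e) ^+ 2 by rewrite hq2; ring.
ring.
Qed.

(** Completing the square, |r e - w|^2 = (r - w.e)^2 + (w.e')^2 with e' = [perp e]; lying inside the
    disc bounds r - w.e by the root in [speed]. *)
Lemma inside_lt_speed smax w e (r : R) : dot e e = 1 ->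
  dot (r *: e - w) (r *: e - w) < smax ^+ 2 -> r < speed smax w e.
Proof.
move=> he hr; have h := dot_perp w he.
have E : dot (r *: e - w) (r *: e - w) = r ^+ 2 * dot e e - 2 * r * dot w e + dot w w.
  by rewrite !dot2 !mxE; ring.
rewrite E he -h in hr; rewrite /speed -ltrBlDl.
apply: (le_lt_trans (ler_norm _)); rewrite -sqrtr_sqr ltr_sqrt; have := sqr_ge0 (r - dot w e); nra.
Qed.

(* 1 / speed is the gauge of a strictly convex disc. *)
Lemma inv_speed_subadd smax w e e' (c : R) f :
  dot w w < smax ^+ 2 -> dot e e = 1 -> dot e' e' = 1 -> dot f f = 1 ->
  e != e' -> 0 < c -> c *: f = e + e' ->
  c / speed smax w f < (speed smax w e)^-1 + (speed smax w e')^-1.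
Proof.
move=> hw he he' hf ne c0 hc.
have s0 := speed_gt0 hw he; have s0' := speed_gt0 hw he'; have sf0 := speed_gt0 hw hf.
have C := speed_on_circle hw he; have C' := speed_on_circle hw he'.
set s := speed smax w e in s0 C *; set s' := speed smax w e' in s0' C' *.
set sf := speed smax w f in sf0 *.
(* The weight balancing the boundary points s e and s' e': since l s = (1 - l) s', their convex
   combination is a multiple of e + e', namely r f with r = c l s. *)
pose l := s' / (s + s').
have ss0 : 0 < s + s' by rewrite addr_gt0.
have l0 : 0 < l by rewrite divr_gt0.
have l1 : l < 1 by rewrite /l ltr_pdivrMr //; lra.
have lE : l * s = (1 - l) * s'.
  by rewrite /l; field; rewrite gt_eqF.
pose r := c * (l * s).
have rE : r *: f = l *: (s *: e) + (1 - l) *: (s' *: e').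
  by rewrite /r mulrC -scalerA hc scalerDr !scalerA lE.
have hr : r < sf.
  apply: inside_lt_speed => //; rewrite rE.
  (* The squared distance to the centre falls short of the convex combination by l (1 - l) |s e - s'
     e'|^2, the source of strictness. *)
  have -> : dot (l *: (s *: e) + (1 - l) *: (s' *: e') - w) (l *: (s *: e) + (1 - l) *: (s' *: e') - w) =
    l * dot (s *: e - w) (s *: e - w) + (1 - l) * dot (s' *: e' - w) (s' *: e' - w)
    - l * (1 - l) * dot (s *: e - s' *: e') (s *: e - s' *: e').
    by rewrite !dot2 !mxE; ring.
  rewrite C C'.
  have : 0 < dot (s *: e - s' *: e') (s *: e - s' *: e').
    rewrite lt0r dot_ge0 andbT; apply: contra_neqN ne => /eqP /dot_eq0 /eqP.
    rewrite subr_eq0 => /eqP E.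
    have ss : s ^+ 2 = s' ^+ 2.
      have : dot (s *: e) (s *: e) = dot (s' *: e') (s' *: e') by rewrite E.
      by rewrite !dotZl !dotZr he he' !mulr1 -!expr2.
    move/eqP: ss; rewrite eqrXn2 // ?ltW // => /eqP ss.
    by move: E; rewrite ss => /(scalerI _); apply; rewrite gt_eqF.
  set d := dot _ _ => d0.
  have := mulr_gt0 (mulr_gt0 l0 (_ : 0 < 1 - l)) d0; rewrite subr_gt0 => /(_ l1).
  lra.
have -> : s^-1 + s'^-1 = (l * s)^-1.
  by rewrite /l; field; rewrite !gt_eqF.
rewrite ltr_pdivrMr // mulrC ltr_pdivlMr //.
by rewrite mulr_gt0.
Qed.

End PlaneVectors.

(** * Scalar differential equations *)

Section Epsilon.
Context {R : realType}.

Lemma is_derive_eps (V : normedModType R) (f : R -> V) (a : R) (d : V) :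
  (forall e : R, 0 < e -> exists2 r : R, 0 < r &
     forall h : R, `|h| < r -> `|f (a + h) - f a - h *: d| <= e * `|h|) ->
  is_derive a 1 f d.
Proof.
move=> H; suff C : h^-1 *: ((f \o shift a) (h *: (1 : R)) - f a) @[h --> 0^'] --> d.
  by split; [apply/cvg_ex; exists d | apply/cvg_lim].
apply/cvgrPdist_le => e e0; have [r r0 Hr] := H e e0.
near=> h.
have h0 : h != 0 by near: h; exact: nbhs_dnbhs_neq.
have hr : `|h| < r by near: h; exact: dnbhs0_lt.
have He := Hr h hr; rewrite [a + h]addrC mulrC in He; rewrite /=.
have -> : d - h^-1 *: (f (h *: 1 + a) - f a) =
   - (h^-1 *: (f (h + a) - f a - h *: d)).
  by rewrite -[h *: 1]/(h * 1) mulr1 !scalerBr scalerA (mulVf h0) scale1r !opprB.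
by rewrite normrN normrZ normfV ler_pdivrMl ?normr_gt0.
Unshelve. all: by end_near. Qed.

Lemma is_deriveP_eps (V : normedModType R) (f : R -> V) (a : R) (d : V) :
  is_derive a 1 f d ->
  forall e : R, 0 < e -> exists2 r : R, 0 < r &
     forall h : R, `|h| < r -> `|f (a + h) - f a - h *: d| <= e * `|h|.
Proof.
move=> [fd fE] e e0.
have : h^-1 *: ((f \o shift a) (h *: (1 : R)) - f a) @[h --> 0^'] --> d.
  by rewrite -fE; exact: fd.
move/cvgrPdist_le => /(_ e e0) [r /= r0 Hr]; exists r => // h hr.
have [->|h0] := eqVneq h 0.
  by rewrite addr0 subrr scale0r subr0 !normr0 mulr0.
have := Hr h; rewrite /= sub0r normrN => /(_ hr h0).
have -> : d - h^-1 *: (f (h *: 1 + a) - f a) =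
   - (h^-1 *: (f (a + h) - f a - h *: d)).
  by rewrite -[h *: 1]/(h * 1) mulr1 [h + a]addrC !scalerBr scalerA (mulVf h0) scale1r !opprB.
rewrite normrN normrZ normfV ler_pdivrMl ?normr_gt0 //.
by rewrite mulrC.
Qed.

End Epsilon.

Section ScalarODE.
Context {R : realType}.
Variables (g : R -> R -> R) (m M : R) (y0 : R).
Hypotheses (m0 : 0 <= m) (gm : forall t y, m <= g t y) (gM : forall t y, g t y <= M).

Fixpoint euler (n k : nat) : R :=
  if k is k'.+1 then euler n k' + g (k'%:R / n.+1%:R) (euler n k') / n.+1%:R
  else y0.

(** Slope bounds are asked only at the nodes visited from k to l: the lemma serves first with the
    global m and M, then with bounds close to one value of [g], once the nodes are known to lie near
    that point. *)
Lemma euler_incr n (k l : nat) (a b : R) : (k <= l)%N ->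
  (forall j, (k <= j < l)%N -> a <= g (j%:R / n.+1%:R) (euler n j) <= b) ->
  a * ((l%:R - k%:R) / n.+1%:R) <= euler n l - euler n k <= b * ((l%:R - k%:R) / n.+1%:R).
Proof.
elim: l => [|l IH] kl H.
  by move: kl; rewrite leqn0 => /eqP ->; rewrite !subrr mul0r !mulr0 lexx.
move: kl; rewrite leq_eqVlt => /orP[/eqP ->|]; first by rewrite !subrr mul0r !mulr0 lexx.
rewrite ltnS => kl.
have /andP[I1 I2] : a * ((l%:R - k%:R) / n.+1%:R) <= euler n l - euler n k <= b * ((l%:R - k%:R) / n.+1%:R).
  by apply: IH => // j /andP[kj jl]; apply: H; rewrite kj ltnS ltnW.
have /andP[G1 G2] : a <= g (l%:R / n.+1%:R) (euler n l) <= b.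
  by apply: H; rewrite kl ltnSn.
have -> : (l.+1%:R - k%:R) / n.+1%:R = (l%:R - k%:R) / n.+1%:R + n.+1%:R^-1 :> R.
  by rewrite -[l.+1]addn1 natrD; ring.
have nV : 0 <= n.+1%:R^-1 :> R by rewrite invr_ge0.
rewrite !mulrDr /= addrAC.
by apply/andP; split; apply: lerD => //; apply: ler_wpM2r.
Qed.

(** [truncn] is 0 on negative numbers, so for t < 0 the approximation keeps its initial value. A
    step function replaces the usual polygon; its jumps, at most [M / n.+1], vanish in the limit. *)
Definition euler_idx (n : nat) (t : R) : nat := Num.truncn (t * n.+1%:R).
Definition euler_step (n : nat) (t : R) : R := euler n (euler_idx n t).

Lemma euler_idx_itv n t : 0 <= t ->
  (euler_idx n t)%:R / n.+1%:R <= t <= (euler_idx n t)%:R / n.+1%:R + n.+1%:R^-1.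
Proof.
move=> t0; have n0 : 0 < n.+1%:R :> R by [].
have /truncn_itv/andP[h1 h2] : 0 <= t * n.+1%:R by rewrite mulr_ge0.
rewrite ler_pdivrMr // h1 /= -[X in _ + X]mul1r -mulrDl ler_pdivlMr //.
by rewrite natr1 ltW.
Qed.

Lemma bound_ge0 : 0 <= M. Proof. by apply: le_trans (gM 0 0); apply: le_trans (gm 0 0). Qed.

(** The grid times below s and t are t - s apart up to one step, whence the error [M / n.+1]; since
    m <= M it serves the lower bound too. *)
Lemma euler_step_incr n s t : 0 <= s <= t ->
  m * (t - s) - M / n.+1%:R <= euler_step n t - euler_step n s <= M * (t - s) + M / n.+1%:R.
Proof.
move=> /andP[s0 st]; have t0 := le_trans s0 st.
have kl : (euler_idx n s <= euler_idx n t)%N by apply/le_truncn/ler_wpM2r.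
have /andP[I1 I2] := euler_incr (a := m) (b := M) kl
  (fun j _ => introT andP (conj (gm (j%:R / n.+1%:R) (euler n j)) (gM _ _))).
have /andP[S1 S2] := euler_idx_itv n s0; have /andP[T1 T2] := euler_idx_itv n t0.
rewrite /euler_step.
have MM := bound_ge0; have mM := le_trans (gm 0 0) (gM 0 0).
rewrite mulrBl in I1 I2.
set a := _ / _ in T1 T2 I1 I2; set b := _ / _ in S1 S2 I1 I2.
set d := n.+1%:R^-1 in S2 T2 *.
have d0 : 0 <= d by rewrite /d invr_ge0.
apply/andP; split.
- apply: le_trans I1.
  have : m * (t - s - d) <= m * (a - b) by apply: ler_wpM2l => //; lra.
  have : m * d <= M * d by apply: ler_wpM2r.
  by rewrite !mulrBr; lra.
- apply: (le_trans I2).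
  have : M * (a - b) <= M * (t - s + d) by apply: ler_wpM2l => //; lra.
  by rewrite !mulrDr; lra.
Qed.

(* Pointwise limits along an ultrafilter give an Arzela-Ascoli extraction
   for free. *)
Lemma euler_limit : exists phi : R -> R, forall s t (e : R), 0 < e ->
  exists n, [/\ n.+1%:R^-1 < e, `|euler_step n s - phi s| < e
                & `|euler_step n t - phi t| < e].
Proof.
have [U [UU sU]] := @ultraFilterLemma nat \oo _.
have FU : ProperFilter U by exact: ultra_proper.
have lim (t : R) : exists l : R, euler_step ^~ t @ U --> l.
  have Hb n : euler_step n t \in `[y0, y0 + M * `|t| + M].
    have MM := bound_ge0.
    have d1 : M / n.+1%:R <= M by rewrite ler_piMr // invf_le1 // ler1n.
    have E0 : euler_step n 0 = y0 by rewrite /euler_step /euler_idx mul0r truncn0.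
    have [t0|t0] := leP 0 t.
      have /andP[_] := @euler_step_incr n 0 t (introT andP (conj (lexx 0) t0)).
      rewrite E0 subr0 in_itv /= ger0_norm // => h2.
      have /andP[+ _] := @euler_incr n 0 (euler_idx n t) m M isT
        (fun j _ => introT andP (conj (gm (j%:R / n.+1%:R) (euler n j)) (gM _ _))).
      have : 0 <= m * (((euler_idx n t)%:R - 0%:R) / n.+1%:R).
        by rewrite mulr_ge0 // subr0 divr_ge0.
      rewrite -/(euler_step n t) /= => h3 h4.
      have h5 := le_trans h3 h4; apply/andP; split; first lra.
      by move: (euler_step n t) (M / _) (M * t) d1 h2 => z1 z2 z3 d1 h2; lra.
    have -> : euler_step n t = y0.
      rewrite /euler_step /euler_idx truncn_floor ifF //.
      by apply/negbTE; rewrite -ltNge pmulr_llt0.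
    by rewrite in_itv /= lexx /= -addrA lerDl addr_ge0 // mulr_ge0.
  have := @segment_compact R y0 (y0 + M * `|t| + M).
  rewrite compact_ultra => /(_ (euler_step ^~ t @ U)) /=.
  case.
  (* The image of [U] is again an ultrafilter: a set or its complement pulls back into [U]. *)
  - split; first exact: fmap_proper_filter.
    move=> G GF sG; apply/seteqP; split => // A GA.
    have [//|nA] := in_ultra_setVsetC (euler_step ^~ t @^-1` A) UU.
    exfalso; apply: (@filter_not_empty _ G GF).
    have : G (~` A) by exact: sG.
    by move=> /(filterI GA); rewrite setICr.
  - by apply: filterE => n; exact: Hb.
  - by move=> l [_ hl]; exists l.
have [phi Hphi] := choice lim; exists phi => s t e e0.
have Hs : \forall n \near U, `|euler_step n s - phi s| < e.
  by have /cvgrPdist_lt /(_ _ e0) := Hphi s; apply: filterS => n; rewrite distrC.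
have Ht : \forall n \near U, `|euler_step n t - phi t| < e.
  by have /cvgrPdist_lt /(_ _ e0) := Hphi t; apply: filterS => n; rewrite distrC.
have Hn : \forall n \near U, n.+1%:R^-1 < e.
  apply: sU; exact: near_infty_natSinv_lt (PosNum e0).
(* One index good at both times, so inequalities linking s and t survive the limit. *)
have [n [? [? ?]]] := filter_ex (filterI Hn (filterI Hs Ht)).
by exists n.
Qed.

(** On a short interval with endpoint a, the Euler nodes stay close to (a, phi a), so every slope
    used is within e of [g a (phi a)]; the increment of phi inherits this bound in the limit. *)
Lemma scalar_ode_aux : exists phi : R -> R,
  [/\ phi 0 = y0,
      forall s t : R, 0 <= s <= t -> m * (t - s) <= phi t - phi s <= M * (t - s) &
      forall t : R, 0 < t -> {for (t, phi t), continuous (fun z : R * R => g z.1 z.2)} ->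
        is_derive t 1 phi (g t (phi t))].
Proof.
have [phi Hphi] := euler_limit; exists phi.
have MM := bound_ge0.
have M2 : 0 < M + 2 by lra.
have inc (s t : R) : 0 <= s <= t -> m * (t - s) <= phi t - phi s <= M * (t - s).
  move=> st; apply/andP; split; apply/ler_addgt0Pl => e e0.
  - have [n [n1 n2 n3]] := Hphi s t (e / (M + 2)) (divr_gt0 e0 M2).
    have /andP[h1 h2] := euler_step_incr n st.
    have : M / n.+1%:R <= M * (e / (M + 2)) by apply: ler_wpM2l => //; exact: ltW.
    have E : M * (e / (M + 2)) + 2 * (e / (M + 2)) = e by field; lra.
    move: (euler_step n s) (euler_step n t) (M / _) n2 n3 h1 h2 => ps pt q.
    by rewrite !ltr_norml => /andP[? ?] /andP[? ?] ? ? ?; lra.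
  - have [n [n1 n2 n3]] := Hphi s t (e / (M + 2)) (divr_gt0 e0 M2).
    have /andP[h1 h2] := euler_step_incr n st.
    have : M / n.+1%:R <= M * (e / (M + 2)) by apply: ler_wpM2l => //; exact: ltW.
    have E : M * (e / (M + 2)) + 2 * (e / (M + 2)) = e by field; lra.
    move: (euler_step n s) (euler_step n t) (M / _) n2 n3 h1 h2 => ps pt q.
    by rewrite !ltr_norml => /andP[? ?] /andP[? ?] ? ? ?; lra.
split => //.
- apply/eqP; rewrite -subr_eq0 -normr_le0; apply/ler_addgt0Pl => e e0; rewrite addr0.
  have [n [_ + _]] := Hphi 0 0 e e0.
  rewrite /euler_step /euler_idx mul0r truncn0 /= distrC => /ltW; done.
move=> a a0 gc; apply: is_derive_eps => e e0.
have /cvgrPdist_lt/(_ _ e0) := gc.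
case/nbhs_ballP => d /= d0 Hd.
have {}Hd t y : `|t - a| < d -> `|y - phi a| < d -> `|g t y - g a (phi a)| < e.
  move=> h1 h2; rewrite distrC; apply: (Hd (t, y)); split => /=;
  by rewrite /ball /= distrC.
(* [r <= a] keeps a + h nonnegative. The other bound d2 satisfies (2 M + 4) d2 = d: nodes will lie
   within 2 d2 of a in time and within (2 M + 1) d2 of phi a in value. *)
pose r := Num.min a (d / (2 * M + 4)).
have d20 : 0 < d / (2 * M + 4) by rewrite divr_gt0 //; lra.
have E2 : 2 * M * (d / (2 * M + 4)) + 4 * (d / (2 * M + 4)) = d by field; lra.
set d2 := d / _ in d20 E2 r.
have r0 : 0 < r by rewrite lt_min a0.
exists r => // h; rewrite lt_min => /andP[ha hd].
set G := g a (phi a) in Hd *.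
have G0 : 0 <= G by apply: le_trans (gm _ _).
(* Taking a as either endpoint covers both signs of h. *)
suff key (s t : R) : 0 <= s <= t -> (a = s) \/ (a = t) -> t - s < d2 ->
    `|phi t - phi s - (t - s) * G| <= e * (t - s).
  have [h0|h0] := leP 0 h.
    have := key a (a + h); rewrite (_ : a + h - a = h) ?(ger0_norm h0); last by ring.
    apply.
    - by rewrite ltW //= lerDl.
    - by left.
    - by move: hd; rewrite ger0_norm.
  have K := key (a + h) a; rewrite (_ : a - (a + h) = - h) in K; last by ring.
  rewrite (ltr0_norm h0) -normrN.
  rewrite (_ : - _ = phi a - phi (a + h) - - h * G); last first.
    by rewrite -[h *: G]/(h * G); ring.
  apply: K.
  - by move: ha; rewrite ltr_norml => /andP[? _]; apply/andP; split; lra.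
  - by right.
  - by move: hd; rewrite ltr0_norm.
move=> st ast std; apply/ler_addgt0Pl => eta eta0.
have C0 : 0 < G + e + 2 by lra.
(* The total error is at most 2 [e1] from the approximations at s and t, plus (G + e) q from the
   step size q < [e1]; hence the divisor. *)
pose e1 := Num.min (eta / (G + e + 2)) d2.
have e10 : 0 < e1 by rewrite lt_min d20 divr_gt0.
have [n [n1 n2 n3]] := Hphi s t e1 e10.
have e1C : e1 * (G + e + 2) <= eta by rewrite -ler_pdivlMr // ge_min lexx.
have e1d : e1 <= d2 by rewrite ge_min lexx orbT.
have /andP[s0 st'] := st; have t0 := le_trans s0 st'.
have kl : (euler_idx n s <= euler_idx n t)%N by apply/le_truncn/ler_wpM2r.
have gmM j : m <= g (j%:R / n.+1%:R) (euler n j) <= M by rewrite gm gM.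
have /andP[S1 S2] := euler_idx_itv n s0; have /andP[T1 T2] := euler_idx_itv n t0.
rewrite /euler_step in n2 n3.
set k := euler_idx n s in kl S1 S2 n2; set l := euler_idx n t in kl T1 T2 n3.
set q := n.+1%:R^-1 in n1 S2 T2.
have q0 : 0 < q by rewrite /q invr_gt0.
have X1 : (l%:R - k%:R) / n.+1%:R <= t - s + q by rewrite mulrBl; move: (k%:R / _) (l%:R / _) S1 S2 T1 T2 => b c *; lra.
have X2 : t - s - q <= (l%:R - k%:R) / n.+1%:R by rewrite mulrBl; move: (k%:R / _) (l%:R / _) S1 S2 T1 T2 => b c *; lra.
have /andP[_ I2] := euler_incr kl (fun j _ => gmM j).
have I3 : M * ((l%:R - k%:R) / n.+1%:R) <= M * (2 * d2).
  by apply: ler_wpM2l => //; move: (_ / _) X1 => z ?; lra.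
have /andP[J1 J2] : (G - e) * ((l%:R - k%:R) / n.+1%:R) <= euler n l - euler n k
    <= (G + e) * ((l%:R - k%:R) / n.+1%:R).
  (* As m >= 0 the nodes are nondecreasing, so node j is squeezed between nodes k and l, which are
     close to phi s and phi t. *)
  apply: euler_incr => // j /andP[kj jl].
  have /andP[K1 _] := euler_incr kj (fun j _ => gmM j).
  have /andP[L1 _] := euler_incr (ltnW jl) (fun j _ => gmM j).
  have K2 : 0 <= m * ((j%:R - k%:R) / n.+1%:R).
    by rewrite mulr_ge0 // divr_ge0 // subr_ge0 ler_nat.
  have L2 : 0 <= m * ((l%:R - j%:R) / n.+1%:R).
    by rewrite mulr_ge0 // divr_ge0 // subr_ge0 ler_nat ltnW.
  have jk : k%:R / n.+1%:R <= j%:R / n.+1%:R :> R by rewrite ler_wpM2r ?ler_nat.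
  have jl' : j%:R / n.+1%:R <= l%:R / n.+1%:R :> R by rewrite ler_wpM2r ?ler_nat ?(ltnW jl).
  have Hj : `|j%:R / n.+1%:R - a| < d.
    move: (j%:R / _) (k%:R / _) (l%:R / _) S1 S2 T1 T2 jk jl' => xj xk xl S1 S2 T1 T2 jk jl'.
    have Md : 0 <= M * d2 by rewrite mulr_ge0 // ltW.
    rewrite ltr_norml; clear -S1 S2 T1 T2 jk jl' ast st' std n1 q0 e1d E2 d20 Md.
    by apply/andP; split; case: ast => ->; lra.
  have He : `|euler n j - phi a| < d.
    move: (le_trans K2 K1) (le_trans L2 L1) (le_trans I2 I3) n2 n3.
    move: (euler n j) (euler n k) (euler n l) => xj xk xl z1 z2 z3.
    rewrite !ltr_norml => /andP[y1 y2] /andP[y3 y4].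
    have Md : 0 <= M * d2 by rewrite mulr_ge0 // ltW.
    clear -z1 z2 z3 y1 y2 y3 y4 Md ast e1d E2 d20.
    by apply/andP; split; case: ast => ->; lra.
  have := Hd _ _ Hj He; rewrite ltr_norml => /andP[h1 h2].
  by clear -h1 h2; apply/andP; split; lra.
set X := _ / _ in X1 X2 J1 J2.
have ? : G * (t - s - q) <= G * X by apply: ler_wpM2l.
have ? : G * X <= G * (t - s + q) by apply: ler_wpM2l.
have ? : e * X <= e * (t - s + q) by apply: ler_wpM2l => //; exact: ltW.
have ? : G * q <= G * e1 by apply: ler_wpM2l => //; exact: ltW.
have ? : e * q <= e * e1 by apply: ler_wpM2l => //; exact: ltW.
move: J1 J2 n2 n3; move: (euler n k) (euler n l) => xk xl J1 J2.
rewrite !ltr_norml => /andP[? ?] /andP[? ?].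
by rewrite ler_norml; apply/andP; split; lra.
Qed.

End ScalarODE.

(* Peano's existence theorem for scalar equations, with [g] bounded but
   continuity required only at points of the graph of the solution. *)
Lemma scalar_ode (R : realType) (g : R -> R -> R) (m M t0 y0 : R) :
  0 <= m -> (forall t y, m <= g t y <= M) ->
  exists phi : R -> R,
  [/\ phi t0 = y0,
      forall s t : R, t0 <= s <= t -> m * (t - s) <= phi t - phi s <= M * (t - s) &
      forall t : R, t0 < t -> {for (t, phi t), continuous (fun z : R * R => g z.1 z.2)} ->
        is_derive t 1 phi (g t (phi t))].
Proof.
move=> m0 gmM; pose g' t y := g (t + t0) y.
have gm' t y : m <= g' t y by have /andP[] := gmM (t + t0) y.
have gM' t y : g' t y <= M by have /andP[] := gmM (t + t0) y.
have [phi [p0 pinc pder]] := scalar_ode_aux y0 m0 gm' gM'.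
exists (fun t => phi (t - t0)); split; first by rewrite subrr.
- move=> s t st; have := pinc (s - t0) (t - t0).
  rewrite (_ : t - t0 - (s - t0) = t - s); last by ring.
  by apply; apply/andP; split; lra.
- move=> t tt gc; have tt0 : 0 < t - t0 by rewrite subr_gt0.
  have := pder _ tt0; rewrite /g' subrK => D.
  apply: is_derive_eps => e e0.
  have /is_deriveP_eps/(_ e e0) : is_derive (t - t0) 1 phi (g t (phi (t - t0))).
    apply: D.
    have H1 : (fun z : R * R => z.1 + t0) z @[z --> (t - t0, phi (t - t0))] --> t.
      rewrite -[X in _ --> X](subrK t0); apply: cvgD; last exact: cvg_cst.
      exact: cvg_fst.
    have H2 : (fun z : R * R => z.2) z @[z --> (t - t0, phi (t - t0))] --> phi (t - t0).
      exact: cvg_snd.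
    have C1 := @cvg_pair _ _ _ _ _ _ (nbhs_filter _) (nbhs_filter _) (nbhs_filter _) _ _ H1 H2.
    have C2 := cvg_comp _ _ C1 gc.
    by rewrite /prop_for /continuous_at; move: C2; rewrite /comp /= subrK.
  by move=> [r r0 H]; exists r => // h /H; rewrite [t + h - t0]addrAC.
Qed.

(** * Mean value inequalities with finitely many exceptional times *)

Lemma avoid_seq (R : realFieldType) (E : seq R) (a b : R) :
  a < b -> exists2 c, a < c < b & c \notin E.
Proof.
elim: E a b => [|x E IH] a b ab.
  by exists ((a + b) / 2) => //; apply/andP; split; lra.
have [xm|xm] := leP x ((a + b) / 2).
- have [|c /andP[c1 c2] cE] := IH ((a + b) / 2) b; first lra.
  exists c; first by apply/andP; split; lra.
  by rewrite inE negb_or cE andbT; apply: contraTneq c1 => ->; rewrite -leNgt.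
- have [|c /andP[c1 c2] cE] := IH a ((a + b) / 2); first lra.
  exists c; first by apply/andP; split; lra.
  by rewrite inE negb_or cE andbT; apply: contraTneq c2 => ->; rewrite -leNgt ltW.
Qed.

Lemma within_itv_sub (R : realType) (T : topologicalType) (f : R -> T) (a b a' b' : R) :
  {within `[a, b], continuous f} -> a <= a' -> b' <= b ->
  {within `[a', b'], continuous f}.
Proof.
move=> h aa bb; apply: continuous_subspaceW h => x /=.
by rewrite !in_itv /= => /andP[? ?]; apply/andP; split; lra.
Qed.

(** Induction on [E]: continuity allows splitting the interval at an exceptional point inside it,
    and the two estimates add up. *)
Lemma mean_value_le (R : realType) (f : R -> R) (M : R) (E : seq R) (a b : R) :
  a <= b -> {within `[a, b], continuous f} ->
  (forall t, a < t < b -> t \notin E -> exists2 d, is_derive t 1 f d & d <= M) ->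
  f b - f a <= M * (b - a).
Proof.
elim: E a b => [|x E IH] a b ab fc H.
  have H' t : exists d, t \in `]a, b[ -> is_derive t 1 f d /\ d <= M.
    have [tab|] := boolP (t \in `]a, b[); last by exists 0.
    have [|//|d ? ?] := H t; first by move: tab; rewrite in_itv.
    by exists d.
  have [df Hdf] := choice H'.
  move: ab; rewrite le_eqVlt => /orP[/eqP ->|ab]; first by rewrite !subrr mulr0.
  have [c cab ->] := MVT ab (fun x xab => (Hdf x xab).1) fc.
  by apply: ler_wpM2r; [rewrite subr_ge0 ltW | exact: (Hdf c cab).2].
have [/andP[ax xb]|xab] := boolP (a < x < b).
  have h1 : f x - f a <= M * (x - a).
    apply: IH; [exact: ltW | apply: within_itv_sub fc _ _ => //; exact: ltW |].
    move=> t /andP[t1 t2] tE; apply: H; first by rewrite t1 (lt_trans t2).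
    by rewrite inE negb_or tE lt_eqF.
  have h2 : f b - f x <= M * (b - x).
    apply: IH; [exact: ltW | apply: within_itv_sub fc _ _ => //; exact: ltW |].
    move=> t /andP[t1 t2] tE; apply: H; first by rewrite t2 (lt_trans _ t1).
    by rewrite inE negb_or tE gt_eqF.
  by move: h1 h2; rewrite !mulrBr; lra.
apply: IH => // t tab tE; apply: H => //.
by rewrite inE negb_or tE andbT; apply: contraNneq xab => <-.
Qed.

Lemma mean_value_ge (R : realType) (f : R -> R) (m : R) (E : seq R) (a b : R) :
  a <= b -> {within `[a, b], continuous f} ->
  (forall t, a < t < b -> t \notin E -> exists2 d, is_derive t 1 f d & m <= d) ->
  m * (b - a) <= f b - f a.
Proof.
move=> ab fc H.
have : (- f) b - (- f) a <= - m * (b - a).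
  apply: (@mean_value_le _ _ _ E) => //.
    by move=> x; apply: continuousN; exact: fc.
  move=> t tab tE; have [d d1 d2] := H t tab tE.
  by exists (- d); [exact: is_deriveN | rewrite lerN2].
by rewrite mulNr -[(- f) b]/(- f b) -[(- f) a]/(- f a); lra.
Qed.

(** * First-order expansions in the plane and continuity of the speed *)

Section VectorCalculus.
Context {R : realType}.
Implicit Types (x e : 'rV[R]_2) (u : 'rV[R]_2 -> R) (y : R -> 'rV[R]_2).

Lemma grad_eps u x : differentiable u x -> forall e : R, 0 < e ->
  exists2 r : R, 0 < r & forall h : 'rV[R]_2, `|h| < r ->
    `|u (x + h) - u x - dot (grad u x) h| <= e * `|h|.
Proof.
move=> du e e0.
have dE h : 'd u x h = dot (grad u x) h.
  have -> : h = h 0 0 *: delta_mx 0 0 + h 0 1 *: delta_mx 0 1.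
    by apply: rV2P; rewrite !mxE /= ?mulr1 ?mulr0 ?addr0 ?add0r.
  rewrite linearD !linearZ /= dot2 !mxE /= ?mulr1 ?mulr0 ?addr0 ?add0r.
  by rewrite !deriveE // ![_ *: ('d _ _ _)]mulrC.
have [_ /eqaddoP H] := (diff_locallyP x u).1 du.
have := H e e0; case/nbhs_ballP => r /= r0 Hr; exists r => // h hr.
have K : `|u (h + x) - (u x + 'd u x h)| <= e * `|h|.
  by apply: (Hr h); rewrite -ball_normE /ball_ /= sub0r normrN.
by rewrite -dE [x + h]addrC -addrA -opprD.
Qed.

Lemma is_derive_dot y (t : R) (d e : 'rV[R]_2) :
  is_derive t 1 y d -> is_derive t 1 (fun s => dot (y s) e) (dot d e).
Proof.
move=> /is_deriveP_eps H; apply: is_derive_eps => k k0.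
have C0 : 0 < 2 * `|e| + 1 by apply: ltr_wpDl => //; rewrite mulr_ge0.
have [r r0 Hr] := H _ (divr_gt0 k0 C0); exists r => // h /Hr hh.
have -> : dot (y (t + h)) e - dot (y t) e - h *: dot d e =
    dot (y (t + h) - y t - h *: d) e.
  by rewrite !dotBl dotZl.
apply: le_trans (dot_le _ _) _.
set n := `|_ - _| in hh *.
apply: (@le_trans _ _ ((2 * `|e| + 1) * (k / (2 * `|e| + 1) * `|h|))).
  have n0 : 0 <= n by rewrite /n.
  apply: (@le_trans _ _ ((2 * `|e| + 1) * n)); last by apply: ler_wpM2l => //; exact: ltW.
  by rewrite mulrDl mul1r; have : 2 * n * `|e| = 2 * `|e| * n by [ring]; lra.
by rewrite mulrA mulrCA divff ?gt_eqF // mulr1.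
Qed.

(** [Num.sqrt] vanishes on negative numbers and is continuous everywhere, which gives continuity
    even where the radicand is negative. *)
Lemma speed_continuous (smax : R) :
  continuous (fun z : 'rV[R]_2 * 'rV[R]_2 => speed smax z.1 z.2).
Proof.
move=> z; rewrite /speed.
have c1 j : {for z, continuous (fun z : 'rV[R]_2 * 'rV[R]_2 => z.1 0 j)}.
  apply: (@continuous_comp _ _ _ fst (fun M : 'rV[R]_2 => M 0 j)); first exact: cvg_fst.
  exact: coord_continuous.
have c2 j : {for z, continuous (fun z : 'rV[R]_2 * 'rV[R]_2 => z.2 0 j)}.
  apply: (@continuous_comp _ _ _ snd (fun M : 'rV[R]_2 => M 0 j)); first exact: cvg_snd.
  exact: coord_continuous.
have -> : (fun z : 'rV[R]_2 * 'rV[R]_2 => dot z.1 z.2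
     + Num.sqrt (smax ^+ 2 - dot z.1 (perp z.2) ^+ 2)) =
  (fun z => (z.1 0 0 * z.2 0 0 + z.1 0 1 * z.2 0 1) +
     Num.sqrt (smax ^+ 2 - (z.1 0 1 * z.2 0 0 - z.1 0 0 * z.2 0 1) *
                           (z.1 0 1 * z.2 0 0 - z.1 0 0 * z.2 0 1))).
  apply/funext => w; rewrite !dot2 !(vec20, vec21).
  by congr (_ + Num.sqrt _); ring.
apply: cvgD; first by apply: cvgD; apply: cvgM; by [exact: c1 | exact: c2].
apply: (@continuous_comp _ _ _ (fun z : 'rV[R]_2 * 'rV[R]_2 => smax ^+ 2 - (z.1 0 1 * z.2 0 0 - z.1 0 0 * z.2 0 1) * (z.1 0 1 * z.2 0 0 - z.1 0 0 * z.2 0 1)) Num.sqrt); last exact: sqrt_continuous.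
apply: cvgB; first exact: cvg_cst.
by apply: cvgM; apply: cvgB; apply: cvgM; by [exact: c1 | exact: c2].
Qed.

End VectorCalculus.

(** * Motions along a curve *)

Section Current.
Context {R : realType}.
Variables (Om : set 'rV[R]_2) (smax Tf : R) (v : 'rV[R]_2 -> R -> 'rV[R]_2).
Hypotheses (smax_gt0 : 0 < smax)
  (v_cont : {within Om `*` `[0, Tf], continuous (fun z : 'rV[R]_2 * R => v z.1 z.2)})
  (v_lt : forall (x : 'rV[R]_2) (t : R), Om x -> 0 <= t <= Tf -> enorm (v x t) < smax).

Lemma dot_current_lt (x : 'rV[R]_2) (t : R) :
  Om x -> 0 <= t <= Tf -> dot (v x t) (v x t) < smax ^+ 2.
Proof. by move=> Ox tT; apply: enorm_lt => //; exact: v_lt. Qed.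

Lemma current_continuous (x : 'rV[R]_2) (t : R) : interior Om x -> 0 < t < Tf ->
  {for (x, t), continuous (fun z : 'rV[R]_2 * R => v z.1 z.2)}.
Proof.
move=> xO /andP[t0 tT].
have near_dom : \forall z \near (x, t), (Om `*` `[0, Tf]) z.
  exists (Om, `[0, Tf]%classic) => //=; split => //=.
  have : t \in `]0, Tf[ by rewrite in_itv /= t0.
  by move=> /near_in_itvoo; apply: filterS => z; rewrite /= !in_itv /= => /andP[/ltW -> /ltW ->].
have /subspace_continuousP/(_ (x, t)) C := v_cont.
move=> P /(C (nbhs_singleton near_dom)); rewrite /fmap /within /= => HP.
by apply: filterS2 near_dom HP => z Az; apply.
Qed.

(** [F] is left general for two uses: the speed projected on a direction for the rate of arrival,
    and the speed itself for the added segment. *)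
Lemma current_near (F : 'rV[R]_2 * 'rV[R]_2 -> R) (x : 'rV[R]_2) (t : R) (e : 'rV[R]_2) :
  interior Om x -> 0 < t < Tf -> {for (v x t, e), continuous F} ->
  forall k : R, 0 < k -> exists2 d : R, 0 < d & forall (z : 'rV[R]_2) (tau : R) (e' : 'rV[R]_2),
    `|z - x| < d -> `|tau - t| < d -> `|e' - e| < d ->
    `|F (v z tau, e') - F (v x t, e)| < k.
Proof.
move=> xO tT Fc k k0.
have /cvgrPdist_lt /(_ _ k0) := Fc.
case/nbhs_ballP => d1 /= d10 H1.
have /cvgrPdist_lt /(_ _ d10) := current_continuous xO tT.
case/nbhs_ballP => d2 /= d20 H2.
exists (Num.min d1 d2); first by rewrite lt_min d10.
move=> z tau e'; rewrite !lt_min => /andP[_ z2] /andP[_ t2] /andP[e1 _].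
rewrite distrC; apply: (H1 (_, _)); split => /=.
- rewrite -ball_normE /ball_ /=; apply: (H2 (z, tau)); split => /=.
  + by rewrite -ball_normE /ball_ /= distrC.
  + by rewrite /ball /= distrC.
- by rewrite -ball_normE /ball_ /= distrC.
Qed.

Section Motion.
Variables (c : curve R) (T : R) (sigma : R -> R).
Hypotheses (c_Om : forall s : R, 0 <= s <= clen c -> Om (cpath c s))
  (mot : motion smax Tf v c T sigma).

Lemma motion_le (s t : R) : 0 <= s -> s <= t -> t <= T -> sigma s <= sigma t.
Proof.
by case: mot => _ _ _ mono _ s0 st tT; apply: mono => //; rewrite in_itv /=;
  apply/andP; split; lra.
Qed.

Lemma motion_range (t : R) : 0 <= t <= T -> 0 <= sigma t <= clen c.
Proof.
case: mot => _ [s0 sT] _ _ _ /andP[t0 tT].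
by rewrite -{1}s0 -sT !motion_le.
Qed.

(* Otherwise the vehicle would rest at the end of the curve, but its speed is
   positive. *)
Lemma motion_lt (t : R) : 0 <= t < T -> sigma t < clen c.
Proof.
move=> /andP[t0 tT]; have [/andP[T0 TTf] [s0 sT] _ _ [E HE]] := mot.
rewrite ltNge; apply/negP => Ls.
(* After t the vehicle would stay at the endpoint; at t', outside [E], the resulting zero derivative
   contradicts a positive multiple of a unit vector. *)
have [t' /andP[t1 t2] tE] := avoid_seq E tT.
have t'0 : 0 < t' < T by rewrite t2 andbT; lra.
have [th [_ dy]] := HE t' t'0 tE.
have sE (s : R) : t < s < T -> sigma s = clen c.
  move=> /andP[s1 s2]; apply/eqP; rewrite eq_le.
  have /andP[_ ->] : 0 <= sigma s <= clen c by apply: motion_range; apply/andP; split; lra.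
  by rewrite (le_trans Ls) // motion_le // ltW.
have dc : is_derive t' 1 (fun s => cpath c (sigma s)) 0.
  have N : \forall s \near t', cst (cpath c (clen c)) s = cpath c (sigma s).
    have : t' \in `]t, T[ by rewrite in_itv /= t1.
    by move=> /near_in_itvoo; apply: filterS => z; rewrite in_itv /= => /sE ->.
  exact: near_eq_is_derive N (is_derive_cst _ _ _).
have : s_max smax v th (cpath c (sigma t')) t' *: e_ th = 0.
  by rewrite -(@derive_val _ _ _ _ _ _ _ dy) (@derive_val _ _ _ _ _ _ _ dc).
rewrite s_maxE => /eqP; rewrite scaler_eq0 gt_eqF /=; last first.
  apply: speed_gt0; last exact: e_unit.
  apply: dot_current_lt; last by apply/andP; split; lra.
  by apply/c_Om/motion_range; apply/andP; split; lra.
move=> /eqP e0; have := e_unit th; rewrite e0 dot2 !mxE !mulr0 addr0.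
by move/eqP; rewrite eq_sym oner_eq0.
Qed.

Lemma motion_T_eq0 : clen c = 0 -> T = 0.
Proof.
move=> c0; have [/andP[T0 _] [s0 _] _ _ _] := mot.
apply/eqP; rewrite eq_le T0 andbT leNgt; apply/negP => T1.
by have := @motion_lt 0; rewrite lexx T1 s0 c0 ltxx => /(_ isT).
Qed.

Lemma motion_T_gt0 : 0 < clen c -> 0 < T.
Proof.
have [/andP[T0 _] [s0 sT] _ _ _] := mot.
move=> L0; rewrite lt0r T0 andbT; apply: contraTneq L0 => TE.
by rewrite -sT TE s0 ltxx.
Qed.

(** The same [sigma], stopped at t: passing times along a curve are travel times along its
    truncations. *)
Lemma motion_trunc (t : R) : 0 <= t <= T ->
  motion smax Tf v (Curve (sigma t) (cpath c)) t sigma.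
Proof.
move=> /andP[t0 tT]; have [/andP[T0 TTf] [s0 sT] sc mono [E HE]] := mot.
split => //.
- by rewrite t0 (le_trans tT).
- exact: within_itv_sub sc _ _.
- by move=> a b; rewrite !in_itv /= => /andP[? ?] /andP[? ?]; apply: mono;
    rewrite in_itv /=; apply/andP; split; lra.
- by exists E => s /andP[s1 s2]; apply: HE; rewrite s1 (lt_le_trans s2).
Qed.

Lemma motion_reaches (l : R) : 0 <= l <= clen c -> exists2 t : R, 0 <= t <= T & sigma t = l.
Proof.
move=> /andP[l0 lc]; have [/andP[T0 TTf] [s0 sT] sc mono _] := mot.
have [|t] := IVT (v := l) T0 sc; last by rewrite in_itv /=; exists t.
by rewrite s0 sT min_l ?max_r ?l0 //; lra.
Qed.

End Motion.
End Current.

(** [g] is a map of the whole line that carries the last piece, so that the final direction [e] is a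
    two-sided derivative. The last clause speaks of any derivative w of the curve because a motion
    supplies the direction of travel in that form. *)
Definition ends_along (R : realType) (c : curve R) (e : 'rV[R]_2) (g : R -> 'rV[R]_2) (r : R) :=
  [/\ 0 < r <= clen c /\ dot e e = 1, continuous g /\ is_derive (clen c) 1 g e,
   forall s : R, clen c - r <= s <= clen c -> cpath c s = g s,
   forall s : R, clen c - r < s < clen c -> piecewise_C1_arclength (Curve s (cpath c)) &
   (forall k : R, 0 < k -> exists2 d : R, 0 < d & forall (s : R) w,
      clen c - d < s < clen c -> is_derive s 1 (cpath c) w -> `|w - e| < k)].

Lemma end_direction (R : realType) (c : curve R) :
  piecewise_C1_arclength c -> 0 < clen c -> exists e g r, ends_along c e g r.
Proof.
move=> [m [b [b0 bm binc bg]]] L0.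
case: m bm binc bg => [|m] bm binc bg; first by move: L0; rewrite -bm b0 ltxx.
have [g [[gd gc] gE]] := bg m (ltnSn m).
have bmL : b m < clen c by rewrite -bm binc.
have bm0 k : (k <= m)%N -> 0 <= b k.
  elim: k => [|k IH] km; first by rewrite b0.
  by apply: le_trans (IH (ltnW km)) _; apply/ltW/binc; rewrite ltnW.
rewrite bm in gE.
exists (derive1 g (clen c)), g, (clen c - b m); split.
- split; first by have := bm0 m (leqnn m); rewrite subr_gt0 bmL /= lerBlDr lerDl.
  have [_ h] := gE (clen c) (introT andP (conj (ltW bmL) (lexx _))).
  by rewrite -(sqr_sqrtr (dot_ge0 _)) -/(enorm _) h expr1n.
- split.
    by move=> s; apply/differentiable_continuous/derivable1_diffP/gd.
  by rewrite derive1E; apply/derivableP/gd.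
- by move=> s; rewrite subKr => /gE[].
- move=> s; rewrite subKr => /andP[s1 s2].
  (* The breakpoints up to [b m] are kept and s replaces the last one. *)
  exists m.+1, (fun k => if (k <= m)%N then b k else s); split => //=.
  + by rewrite ltnn.
  + move=> k km; rewrite -ltnS km; case: ltnP => km'; first exact: binc.
    by rewrite (_ : k = m) //; apply/eqP; rewrite eqn_leq -ltnS km.
  + move=> k km; rewrite -ltnS km; case: ltnP => km'; first exact: bg.
    have -> : k = m by apply/eqP; rewrite eqn_leq -ltnS km.
    exists g; split => // t /andP[t1 t2]; apply: gE; rewrite t1 /=; lra.
- move=> k k0; have /cvgrPdist_lt /(_ _ k0) := gc (clen c).
  case/nbhs_ballP => d /= d0 Hd.
  exists (Num.min d (clen c - b m)); first by rewrite lt_min d0 subr_gt0.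
  move=> s w /andP[s1 s2] dw.
  have [s3 s4] : clen c - s < d /\ b m < s.
    have : clen c - s < Num.min d (clen c - b m) by lra.
    by rewrite lt_min => /andP[? ?]; split; lra.
  (* Strictly inside the last piece the curve and [g] agree near s, so w is the derivative of [g],
     which is continuous. *)
  have -> : w = derive1 g s.
    have : is_derive s 1 g w.
      have N : \forall z \near s, cpath c z = g z.
        have : s \in `]b m, clen c[ by rewrite in_itv /= s4.
        move=> /near_in_itvoo; apply: filterS => z; rewrite in_itv /= => /andP[z1 z2].
        by have [] := gE z (introT andP (conj (ltW z1) (ltW z2))).
      exact: near_eq_is_derive N dw.
    by move=> [_ <-]; rewrite derive1E.
  rewrite distrC; apply: Hd; rewrite -ball_normE /ball_ /= ger0_norm //; lra.
Qed.

Lemma dot_continuous (R : realType) (e : 'rV[R]_2) : continuous (fun a : 'rV[R]_2 => dot a e).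
Proof.
move=> a; have -> : (fun a : 'rV[R]_2 => dot a e) = (fun a => a 0 0 * e 0 0 + a 0 1 * e 0 1).
  by apply/funext => b; rewrite dot2.
have cj j : (fun b : 'rV[R]_2 => b 0 j * e 0 j) @ nbhs a --> a 0 j * e 0 j.
  by apply: cvgMr_tmp; exact: coord_continuous.
exact: cvgD (cj 0) (cj 1).
Qed.

(** With k <= s / 2 and k <= 1 the hypothesis first gives tau <= 4 h / s; reinserting this leaves an
    error of k (1 + 4 / s) h, and division by s concludes. *)
Lemma inv_rate_bound (R : realType) (s h tau k eps : R) :
  0 < s -> 0 <= h -> 0 <= tau -> 0 < k -> k <= 1 -> k <= s / 2 -> k * (1 + 4 / s) <= eps * s ->
  `|h - s * tau| <= k * (h + tau) -> `|tau - h / s| <= eps * h.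
Proof.
move=> s0 h0 tau0 k0 k1 k2 k3; rewrite ler_norml => /andP[H1 H2].
have b1 : k * h <= 1 * h by apply: ler_wpM2r.
have b2 : k * tau <= s / 2 * tau by apply: ler_wpM2r.
have taub : tau <= 4 / s * h.
  rewrite mulrAC ler_pdivlMr // mulrC; lra.
have b3 : k * tau <= k * (4 / s * h) by apply: ler_wpM2l => //; exact: ltW.
have b4 : k * (1 + 4 / s) * h <= eps * s * h by apply: ler_wpM2r.
have E : tau - h / s = (s * tau - h) / s by field; rewrite gt_eqF.
rewrite E normrM normfV (gtr0_norm s0) ler_pdivrMr // ler_norml.
by apply/andP; split; lra.
Qed.

(** * Rate of arrival at the end of a curve *)

Section Rates.
Context {R : realType}.
Variables (Om : set 'rV[R]_2) (smax Tf : R) (v : 'rV[R]_2 -> R -> 'rV[R]_2).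
Hypotheses (smax_gt0 : 0 < smax)
  (v_cont : {within Om `*` `[0, Tf], continuous (fun z : 'rV[R]_2 * R => v z.1 z.2)})
  (v_lt : forall (x : 'rV[R]_2) (t : R), Om x -> 0 <= t <= Tf -> enorm (v x t) < smax).
Variables (c : curve R) (T : R) (sigma : R -> R).
Hypotheses (c_Om : forall s : R, 0 <= s <= clen c -> Om (cpath c s))
  (mot : motion smax Tf v c T sigma)
  (T_gt0 : 0 < T) (T_lt : T < Tf)
  (x_int : interior Om (cpath c (clen c))).

(** The component of the position along e grows at a rate within k of s just before T, since speed
    and direction are then close to their final values; the mean value inequalities give an
    increment s (T - t) up to k (T - t). By differentiability of [g] at the end, the same increment
    is the remaining length up to k times that length. *)
Lemma arrival_rate e g r : ends_along c e g r ->
  let s := speed smax (v (cpath c (clen c)) T) e in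
  forall eps : R, 0 < eps -> exists2 d : R, 0 < d & forall t : R,
    0 <= t <= T -> clen c - sigma t < d ->
    `|T - t - (clen c - sigma t) / s| <= eps * (clen c - sigma t).
Proof.
move=> [[/andP[r0 rL] e1] [gc gd] gE _ dirc] s eps eps0.
have xI := x_int; set L := clen c in rL gd gE dirc s xI *; set x := cpath c L in s xI *.
have TT : 0 <= T <= Tf by rewrite !ltW.
have xOm : Om x by exact: nbhs_singleton.
have s0 : 0 < s by apply: speed_gt0 => //; exact: (dot_current_lt smax_gt0 v_lt).
have gx : g L = x by rewrite /x gE // lexx andbT; lra.
have C0 : 0 < 1 + 4 / s by rewrite addr_gt0 // divr_gt0.
pose k := Num.min 1 (Num.min (s / 2) (eps * s / (1 + 4 / s))).
have k0 : 0 < k by rewrite /k !lt_min ltr01 !divr_gt0 ?mulr_gt0.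
have k1 : k <= 1 by rewrite /k ge_min lexx.
have k2 : k <= s / 2 by rewrite /k !ge_min lexx orbT.
have k3 : k * (1 + 4 / s) <= eps * s by rewrite -ler_pdivlMr // /k !ge_min lexx !orbT.
pose F (z : 'rV[R]_2 * 'rV[R]_2) := speed smax z.1 z.2 * dot z.2 e.
have Fc : {for (v x T, e), continuous F}.
  apply: cvgM; first exact: speed_continuous.
  apply: (@cvg_comp _ _ _ snd (fun a => dot a e)); first exact: cvg_snd.
  exact: dot_continuous.
have TT' : 0 < T < Tf by rewrite T_gt0.
have [d1 d10 H1] := current_near v_cont xI TT' Fc k0.
have [d2 d20 H2] := dirc _ d10.
have k20 : 0 < k / 2 by rewrite divr_gt0.
have [d3 d30 H3] := is_deriveP_eps gd k20.
(* [motion_lt] leaves a positive length after [t0]: a vehicle closer than that to the end has passed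
   [t0], so t is within [d1] of T. *)
pose t0 := Num.max 0 (T - d1).
have t00 : 0 <= t0 < T by rewrite /t0 le_max lexx /= gt_max T_gt0 /= ltrBlDr ltrDl.
have d40 := motion_lt smax_gt0 v_lt c_Om mot t00.
pose d := Num.min (Num.min r d2) (Num.min d3 (Num.min (d1 / 2) (L - sigma t0))).
exists d; first by rewrite /d !lt_min r0 d20 d30 divr_gt0 //= subr_gt0.
move=> t /andP[tp tT]; rewrite /d !lt_min => /andP[/andP[hr hd2] /and3P[hd3 hd1 hd4]].
have near_end (l : R) : L - d3 < l <= L -> `|g l - x + (L - l) *: e| <= k / 2 * (L - l).
  move=> /andP[l1 l2]; have := H3 (l - L); rewrite ler0_norm ?subr_le0 // opprB.
  rewrite (_ : L + (l - L) = l); last by ring.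
  by rewrite gx -scaleNr opprB; apply; lra.
have tt0 : t0 < t.
  rewrite ltNge; apply/negP => tt0; have [_ _ _ mono _] := mot.
  have : sigma t <= sigma t0.
    by case/andP: t00 => t01 t02; apply: mono => //; rewrite in_itv /= ?tp ?tT ?t01 ?(ltW t02).
  lra.
have tTd : T - d1 < t by apply: le_lt_trans tt0; rewrite le_max lexx orbT.
have srange (u : R) : t <= u <= T -> sigma t <= sigma u <= L.
  move=> /andP[u1 u2].
  have /andP[_ ->] : 0 <= sigma u <= L by apply: (motion_range mot); rewrite u2 andbT; lra.
  by rewrite andbT; apply: (motion_le mot) => //; lra.
have ygE (u : R) : t <= u <= T -> cpath c (sigma u) = g (sigma u).
  by move=> /srange /andP[? ?]; apply: gE; apply/andP; split; lra.
set h := L - sigma t in hr hd2 hd3 hd1 hd4 *.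
have hE : h = L - sigma t by [].
have h0 : 0 <= h by have := srange t; rewrite lexx tT subr_ge0 => /(_ isT)/andP[].
pose f (u : R) := dot (g (sigma u)) e.
have fc : {within `[t, T], continuous f}.
  have [_ _ sc _ _] := mot.
  have sc' := within_itv_sub sc tp (lexx T).
  have hc : continuous (fun l => dot (g l) e).
    by move=> l; exact: (cvg_comp _ _ (gc l) (@dot_continuous _ e (g l))).
  by move=> u; exact: (cvg_comp _ _ (sc' u) (hc _)).
have [_ _ _ _ [E HE]] := mot.
have fd (u : R) : t < u < T -> u \notin E -> exists2 w, is_derive u 1 f w & `|w - s| < k.
  move=> /andP[u1 u2] uE.
  have uT : 0 < u < T by rewrite u2 andbT; lra.
  have [th [D1 D2]] := HE u uT uE.
  have tuT : t <= u <= T by rewrite !ltW.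
  have /andP[su1 su2] := srange u tuT.
  have su3 : sigma u < L.
    by apply: (motion_lt smax_gt0 v_lt c_Om mot); rewrite u2 andbT; lra.
  exists (s_max smax v th (cpath c (sigma u)) u * dot (e_ th) e).
    rewrite -dotZl.
    have N : \forall z \near u, dot (cpath c (sigma z)) e = f z.
      have : u \in `]t, T[ by rewrite in_itv /= u1.
      by move=> /near_in_itvoo; apply: filterS => z; rewrite in_itv /f /= => /andP[? ?];
        rewrite ygE // !ltW.
    exact: near_eq_is_derive N (is_derive_dot e D2).
  have -> : s = F (v x T, e) by rewrite /F e1 mulr1.
  rewrite s_maxE; apply: (H1 _ _ (e_ th)).
  - rewrite ygE //; have := near_end (sigma u).
    rewrite su2 andbT => /(_ _) NE; have {}NE := NE (_ : L - d3 < sigma u).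
    have hu : L - sigma u <= h by rewrite /h; lra.
    have e_le := norm_unit e1.
    have -> : g (sigma u) - x = (g (sigma u) - x + (L - sigma u) *: e) - (L - sigma u) *: e.
      by rewrite addrK.
    apply: (le_lt_trans (ler_normB _ _)).
    have {}NE : `|g (sigma u) - x + (L - sigma u) *: e| <= k / 2 * (L - sigma u) by apply: NE; lra.
    have n2 : `|(L - sigma u) *: e| <= L - sigma u.
      rewrite normrZ ger0_norm; last lra.
      by rewrite ler_piMr //; lra.
    have : k / 2 * (L - sigma u) <= 1 * (L - sigma u).
      by clear -k1 k0 su2; apply: ler_wpM2r; lra.
    lra.
  - by rewrite ltr_norml; apply/andP; split; lra.
  - by apply: H2 D1; apply/andP; split; lra.
have U : f T - f t <= (s + k) * (T - t).
  apply: (mean_value_le (E := E)) => // u utT uE; have [w w1 w2] := fd u utT uE.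
  by exists w => //; move: w2; rewrite ltr_norml => /andP[? ?]; lra.
have W : (s - k) * (T - t) <= f T - f t.
  apply: (mean_value_ge (E := E)) => // u utT uE; have [w w1 w2] := fd u utT uE.
  by exists w => //; move: w2; rewrite ltr_norml => /andP[? ?]; lra.
have fTt : f T - f t = h - dot (g (sigma t) - x + h *: e) e.
  have [_ [_ sT] _ _ _] := mot.
  have -> : dot (g (sigma t) - x + h *: e) e = dot (g (sigma t)) e - dot x e + h * dot e e.
    by rewrite !dot2 !mxE; ring.
  by rewrite /f sT -/L gx e1; ring.
have dE : `|dot (g (sigma t) - x + h *: e) e| <= k * h.
  apply: (le_trans (dot_le _ _)).
  have NE : `|g (sigma t) - x + h *: e| <= k / 2 * h.
    by apply: near_end; apply/andP; split; lra.
  have : `|g (sigma t) - x + h *: e| * `|e| <= k / 2 * h * 1.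
    by apply: ler_pM => //; exact: norm_unit.
  lra.
apply: (@inv_rate_bound _ _ _ _ k) => //; first lra.
move: dE; rewrite !ler_norml => /andP[? ?]; apply/andP; split; lra.
Qed.

End Rates.

Lemma lipschitz_within (R : realType) (f : R -> R) (M a b : R) : 0 <= M ->
  (forall s t : R, a <= s <= t -> `|f t - f s| <= M * (t - s)) ->
  {within `[a, b], continuous f}.
Proof.
move=> M0 H; apply/subspace_continuousP => t /=; rewrite in_itv /= => /andP[t1 t2].
have M1 : 0 < M + 1 by lra.
apply/cvgrPdist_lt => k k0; rewrite near_withinE; near=> u.
rewrite /= in_itv /= => /andP[u1 u2].
have tu : `|t - u| < k / (M + 1).
  by near: u; apply/nbhs_ballP; exists (k / (M + 1)) => //=; exact: divr_gt0 k0 M1.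
have {tu} : `|t - u| * (M + 1) < k by rewrite -ltr_pdivlMr.
have [ut|ut] := leP u t.
  rewrite ger0_norm ?subr_ge0 // => ?.
  by apply: le_lt_trans (H u t _) _; [rewrite u1 | nra].
rewrite distrC ger0_norm ?subr_ge0 ?ltW // => ?.
by rewrite distrC; apply: le_lt_trans (H t u _) _; [rewrite t1 ltW | nra].
Unshelve. all: by end_near. Qed.

Lemma clamp_lipschitz (R : realType) (m M a b : R) : m <= M ->
  `|Num.max m (Num.min M a) - Num.max m (Num.min M b)| <= `|a - b|.
Proof.
move=> mM; have := ler_norm (a - b); have := ler_norm (b - a).
rewrite [`|b - a|]distrC; move: `|a - b| => n n1 n2; rewrite ler_norml.
have [Ma|aM] := leP M a; have [Mb|bM] := leP M b;
  rewrite ?(max_r mM) ?(min_l Ma) ?(min_l Mb).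
all: repeat match goal with |- context [Num.max ?u ?w] => have [?|?] := leP u w end.
all: by apply/andP; split; lra.
Qed.

(** * Prolonging a curve by a segment *)

Section Extension.
Context {R : realType}.
Implicit Types (c : curve R) (e x : 'rV[R]_2).

Lemma is_derive_along x e (f : R -> R) (t d L : R) : is_derive t 1 f d ->
  is_derive t 1 (fun z => x + (f z - L) *: e) (d *: e).
Proof.
move=> /is_deriveP_eps H; apply: is_derive_eps => k k0.
have C0 : 0 < `|e| + 1 by rewrite ltr_wpDl.
have [r r0 Hr] := H _ (divr_gt0 k0 C0); exists r => // h /Hr hh.
have -> : x + (f (t + h) - L) *: e - (x + (f t - L) *: e) - h *: (d *: e) =
    (f (t + h) - f t - h *: d) *: e.
  by apply: rV2P; rewrite !mxE -[h *: d]/(h * d); ring.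
rewrite normrZ.
apply: (@le_trans _ _ (k / (`|e| + 1) * `|h| * (`|e| + 1))).
  by apply: ler_pM => //; rewrite lerDl.
by rewrite mulrAC divfK // gt_eqF.
Qed.

Definition extend c e (h : R) : curve R :=
  Curve (clen c + h) (fun s =>
    if s <= clen c then cpath c s else cpath c (clen c) + (s - clen c) *: e).

Lemma extend_piecewise c e (h : R) : dot e e = 1 -> 0 < h ->
  piecewise_C1_arclength c -> piecewise_C1_arclength (extend c e h).
Proof.
move=> e1 h0 [m [b [b0 bm binc bg]]].
have bmono k i : (k + i <= m)%N -> b k <= b (k + i)%N.
  elim: i => [|i IH] im; first by rewrite addn0.
  rewrite addnS in im *; apply: le_trans (IH (ltnW im)) _.
  exact/ltW/binc.
have bL k : (k <= m)%N -> b k <= clen c.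
  by move=> km; rewrite -bm -[leRHS](congr1 b (subnKC km)) bmono // subnKC.
exists m.+1, (fun k => if (k <= m)%N then b k else clen c + h); split => //=.
- by rewrite ltnn.
- move=> k km; rewrite -ltnS km; case: ltnP => km'; first exact: binc.
  have -> : k = m by apply/eqP; rewrite eqn_leq -ltnS km.
  by rewrite bm ltrDl.
- move=> k km; rewrite -ltnS km; case: ltnP => km'.
    have [g [gC gE]] := bg k km'; exists g; split => // s sb.
    have [g1 g2] := gE s sb; rewrite ifT //.
    by case/andP: sb => _ /le_trans; apply; apply: bL.
  have -> : k = m by apply/eqP; rewrite eqn_leq -ltnS km.
  rewrite bm.
  have D (s : R) : is_derive s 1 (fun s => cpath c (clen c) + (s - clen c) *: e) e.
    by rewrite -[X in is_derive _ _ _ X]scale1r; apply: is_derive_along; exact: is_derive_id.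
  have D1 : derive1 (fun s => cpath c (clen c) + (s - clen c) *: e) = cst e.
    by apply/funext => s; rewrite derive1E (@derive_val _ _ _ _ _ _ _ (D s)).
  exists (fun s => cpath c (clen c) + (s - clen c) *: e); split.
    split; first by move=> s; exact: (@ex_derive _ _ _ _ _ _ _ (D s)).
    by rewrite D1; exact: cst_continuous.
  move=> s /andP[s1 s2]; split; last by rewrite D1 /enorm e1 sqrtr1.
  case: ifPn => // sL; have -> : s = clen c by apply/eqP; rewrite eq_le sL.
  by rewrite subrr scale0r addr0.
Qed.

Lemma extend_connects (Om : set 'rV[R]_2) xS x c e (h : R) : dot e e = 1 -> 0 < h ->
  (forall z, `|z - x| <= h -> Om z) -> connects Om xS x c ->
  connects Om xS (x + h *: e) (extend c e h).
Proof.
move=> e1 h0 ball_Om [cp c0 cL cOm].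
have L0 : 0 <= clen c.
  case: cp => m [b [b0 bm binc _]]; rewrite -bm.
  suff : forall k, (k <= m)%N -> 0 <= b k by apply.
  elim=> [|k IH] km; first by rewrite b0.
  by apply: le_trans (IH (ltnW km)) _; apply/ltW/binc.
split; first exact: extend_piecewise.
- by rewrite /= L0.
- by rewrite /= gerDl leNgt h0 /= cL addrAC subrr add0r.
- move=> s /= /andP[s0 sL]; case: ifPn => sc; first by apply: cOm; rewrite s0.
  rewrite -ltNge in sc; apply: ball_Om; rewrite cL addrAC subrr add0r normrZ.
  have sL0 : 0 <= s - clen c by rewrite subr_ge0 ltW.
  rewrite (ger0_norm sL0); apply: le_trans (_ : s - clen c <= h); last by rewrite lerBlDl.
  by rewrite ler_piMr ?norm_unit.
Qed.

Variables (Om : set 'rV[R]_2) (smax Tf : R) (v : 'rV[R]_2 -> R -> 'rV[R]_2).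
Hypotheses (smax_gt0 : 0 < smax)
  (v_cont : {within Om `*` `[0, Tf], continuous (fun z : 'rV[R]_2 * R => v z.1 z.2)})
  (v_lt : forall (x : 'rV[R]_2) (t : R), Om x -> 0 <= t <= Tf -> enorm (v x t) < smax).
Variables (c : curve R) (T : R) (sigma : R -> R).
Hypotheses (c_Om : forall s : R, 0 <= s <= clen c -> Om (cpath c s))
  (mot : motion smax Tf v c T sigma)
  (T_gt0 : 0 < T) (T_lt : T < Tf)
  (x_int : interior Om (cpath c (clen c))).

(** The arc length on the segment solves a scalar equation started at (T, L). Its right-hand side is
    clamped between m and M to obtain global bounds; near (x, T) the clamp is inactive, so the
    solution is a genuine motion and can be glued to [sigma]. *)
Lemma extend_travel_time (th : R) :
  let s := speed smax (v (cpath c (clen c)) T) (e_ th) in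
  forall eps : R, 0 < eps -> exists2 d : R, 0 < d & forall h : R, 0 < h < d ->
    exists2 T', travel_time smax Tf v (extend c (e_ th) h) T'
      & T' <= T + h * (s^-1 + eps).
Proof.
move=> s eps eps0.
have xI := x_int; set L := clen c in s xI *; set x := cpath c L in s xI *.
have e1 := e_unit th; set e := e_ th in s e1 *.
have TT : 0 <= T <= Tf by rewrite !ltW.
have TT' : 0 < T < Tf by rewrite T_gt0.
have xOm : Om x by exact: nbhs_singleton.
have s0 : 0 < s by apply: speed_gt0 => //; exact: (dot_current_lt smax_gt0 v_lt).
have es0 : 0 < 1 + eps * s by rewrite addr_gt0 // mulr_gt0.
(* Chosen so that 1 / m = 1 / s + eps: at speed at least m, the length h takes at most the time
   claimed. *)
pose m := s / (1 + eps * s).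
have m0 : 0 < m by rewrite divr_gt0.
have mV : m^-1 = s^-1 + eps by rewrite /m; field; rewrite !gt_eqF.
have ms : m < s by rewrite /m ltr_pdivrMr // mulrDr mulr1 ltrDl !mulr_gt0.
have k0 : 0 < s - m by rewrite subr_gt0.
have [d1 d10 H1] := current_near (F := fun z => speed smax z.1 z.2) v_cont xI TT'
  (@speed_continuous _ smax (v x T, e)) k0.
have [d2 d20 H2] : exists2 d2 : R, 0 < d2 & forall z, `|z - x| < d2 -> interior Om z.
  have : nbhs x (interior Om) by exact: nbhs_interior.
  case/nbhs_ballP => d2 /= d20 H2; exists d2 => // z zx; apply: H2.
  by rewrite -ball_normE /ball_ /= distrC.
(* Symmetric to m about s: the clamp is inactive wherever the speed is within s - m of s. *)
pose M := s + (s - m).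
pose G (t y : R) := Num.max m (Num.min M (speed smax (v (x + (y - L) *: e) t) e)).
have mM : m <= M by rewrite /M; lra.
have GmM (t y : R) : m <= G t y <= M.
  by rewrite /G le_max lexx /= ge_max mM /= ge_min lexx.
have [phi [phiT phi_inc phi_der]] := scalar_ode T L (ltW m0) GmM.
have Tf0 : 0 < Tf - T by rewrite subr_gt0.
(* The duration is at most h / m, so these bounds keep the segment inside [interior Om], its points
   and times close to (x, T), and the arrival before [Tf]. *)
pose d := Num.min (Num.min d1 d2) (Num.min (m * d1) (m * (Tf - T))).
exists d; first by rewrite /d !lt_min d10 d20 (mulr_gt0 m0 d10) (mulr_gt0 m0 Tf0).
move=> h; rewrite /d !lt_min => /andP[h0 /andP[/andP[hd1 hd2] /andP[hm1 hm2]]].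
have hm3 : h / m < d1 by rewrite ltr_pdivrMr // mulrC.
have hm4 : h / m < Tf - T by rewrite ltr_pdivrMr // mulrC.
have hm0 : 0 < h / m by rewrite divr_gt0.
have M0 : 0 <= M by rewrite /M; lra.
have phic (b : R) : {within `[T, b], continuous phi}.
  apply: (@lipschitz_within _ _ M) => // a t at_.
  have /andP[i1 i2] := phi_inc a t at_.
  have : 0 <= m * (t - a) by rewrite mulr_ge0 ?subr_ge0 ?(ltW m0) //; case/andP: at_.
  by move=> ?; rewrite ger0_norm //; lra.
have [T' T'i phiT'] : exists2 T', T' \in `[T, T + h / m] & phi T' = L + h.
  apply: IVT; [lra | exact: phic |].
  have := phi_inc T (T + h / m); rewrite lexx phiT /= => /(_ _)/andP[|i1 _]; first lra.
  have E : m * (T + h / m - T) = h by field; rewrite gt_eqF.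
  by rewrite ge_min le_max; apply/andP; split; apply/orP; [left|right]; lra.
move: T'i; rewrite in_itv /= => /andP[T'1 T'2].
have TT1 : T < T'.
  rewrite lt_neqAle T'1 andbT; apply: contraTneq h0 => TE.
  by move: phiT'; rewrite -TE phiT; lra.
exists T'; last by rewrite -mV.
have phi_range (t : R) : T <= t <= T' -> L <= phi t <= L + h.
  move=> /andP[t1 t2].
  have := phi_inc T t; rewrite lexx t1 phiT => /(_ isT)/andP[i1 _].
  have := phi_inc t T'; rewrite t1 t2 phiT' => /(_ isT)/andP[i2 _].
  have : 0 <= m * (t - T) by rewrite mulr_ge0 ?subr_ge0 // ltW.
  have : 0 <= m * (T' - t) by rewrite mulr_ge0 ?subr_ge0 // ltW.
  by move=> *; apply/andP; split; lra.
have close (y : R) : L <= y <= L + h -> `|x + (y - L) *: e - x| <= h.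
  move=> /andP[y1 y2]; rewrite addrAC subrr add0r normrZ ger0_norm ?subr_ge0 //.
  apply: le_trans (_ : y - L <= h); last by rewrite lerBlDl.
  by rewrite ler_piMr ?norm_unit // subr_ge0.
have [_ [sig0 sigT] sigc sigmono [E HE]] := mot.
pose sg (t : R) := if t <= T then sigma t else phi t.
have sgphi (t : R) : T <= t -> sg t = phi t.
  move=> Tt; rewrite /sg; case: ifPn => // tT.
  by have -> : t = T by [apply/eqP; rewrite eq_le tT]; rewrite sigT phiT.
exists sg; split.
- by apply/andP; split; lra.
- rewrite /sg /= ltW // leNgt TT1 /=; split => //.
- have -> : `[0, T']%classic = `[0, T] `|` `[T, T'].
    apply/seteqP; split => t /=; rewrite !in_itv /=.
      by move=> /andP[t0 t1]; have [tT|tT] := leP t T; [left|right]; rewrite ?t0 ?t1 ?tT ?ltW.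
    move=> [] /andP[t0 t1]; first by rewrite t0 (le_trans t1).
    by rewrite t1 andbT (le_trans _ t0) // ltW.
  apply: withinU_continuous; [exact: itv_closed | exact: itv_closed | |].
    apply: subspace_eq_continuous sigc => t; rewrite inE /= in_itv /= => /andP[_ tT].
    by rewrite /from_subspace /sg tT.
  apply: subspace_eq_continuous (phic T') => t; rewrite inE /= in_itv /= => /andP[Tt _].
  by rewrite /from_subspace sgphi.
- move=> a b; rewrite !in_itv /= => /andP[a0 aT] /andP[b0 bT] ab.
  have [Tb|bT'] := leP T b.
    rewrite (sgphi b) //; have [Ta|aT'] := leP T a.
      rewrite sgphi //; have := phi_inc a b; rewrite Ta ab => /(_ isT)/andP[i _].
      have : 0 <= m * (b - a) by rewrite mulr_ge0 ?subr_ge0 // ltW.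
      lra.
    have /andP[+ _] := phi_range b (introT andP (conj Tb bT)).
    rewrite /sg (ltW aT'); apply: le_trans.
    have aT1 : 0 <= a <= T by rewrite a0 ltW.
    by have /andP[] := motion_range mot aT1.
  rewrite /sg (ltW bT') ifT; last lra.
  have bT2 := ltW bT'.
  by apply: sigmono => //; rewrite in_itv /= ?a0 ?b0 ?bT2 ?(le_trans ab bT2).
(* T joins the exceptional times, as the segment may form a corner with the end of the curve. *)
exists (T :: E) => t /andP[t0 tT']; rewrite inE negb_or => /andP[tT tE].
have [tlt|tgt|/eqP] := ltgtP t T; last by rewrite (negbTE tT).
- have [|th' [D1 D2]] := HE t _ tE; first by rewrite t0.
  have sgt : sg t = sigma t by rewrite /sg ltW.
  have sL : sigma t < L.
    by apply: (motion_lt smax_gt0 v_lt c_Om mot); rewrite tlt ltW.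
  exists th'; rewrite sgt /= ltW //; split.
    have N : \forall z \near sigma t, cpath c z = cpath (extend c e h) z.
      have : sigma t \in `]sigma t - 1, L[ by rewrite in_itv /= sL andbT; lra.
      by move=> /near_in_itvoo; apply: filterS => z; rewrite in_itv /= => /andP[_ /ltW ->].
    exact: near_eq_is_derive N D1.
  have N : \forall z \near t, cpath c (sigma z) = cpath (extend c e h) (sg z).
    have : t \in `]0, T[ by rewrite in_itv /= t0.
    move=> /near_in_itvoo; apply: filterS => z; rewrite in_itv /= => /andP[z0 zT].
    rewrite /sg (ltW zT) ifT //.
    by have /andP[] := motion_range mot (introT andP (conj (ltW z0) (ltW zT))).
  exact: near_eq_is_derive N D2.
- have Lphi (z : R) : T < z -> L < phi z.
    move=> Tz; have := phi_inc T z; rewrite lexx phiT ltW // => /(_ isT)/andP[i _].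
    have : 0 < m * (z - T) by rewrite mulr_gt0 ?subr_gt0.
    lra.
  have pathE (z : R) : L < z -> cpath (extend c e h) z = x + (z - L) *: e.
    by move=> Lz; rewrite /= leNgt Lz.
  have tr : T <= t <= T' by rewrite !ltW.
  have pr := phi_range t tr; have cl := close _ pr.
  exists th; rewrite sgphi ?ltW // pathE ?Lphi //; split.
    have N : \forall z \near phi t, x + (z - L) *: e = cpath (extend c e h) z.
      have : phi t \in `]L, phi t + 1[ by rewrite in_itv /= Lphi //=; lra.
      by move=> /near_in_itvoo; apply: filterS => z; rewrite in_itv => /andP[/= Lz _]; symmetry; exact: pathE.
    apply: near_eq_is_derive N _.
    by rewrite -[X in is_derive _ _ _ X]scale1r; apply: is_derive_along; exact: is_derive_id.
  have N : \forall z \near t, x + (phi z - L) *: e = cpath (extend c e h) (sg z).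
    have : t \in `]T, T'[ by rewrite in_itv /= tgt.
    move=> /near_in_itvoo; apply: filterS => z; rewrite in_itv => /andP[/= Tz _].
    have Ez := pathE _ (Lphi z Tz).
    by rewrite (sgphi z (ltW Tz)); exact: esym Ez.
  apply: near_eq_is_derive N _; rewrite s_maxE; apply: is_derive_along.
  have tTf : 0 < t < Tf.
    by rewrite t0 (lt_trans tT') // (le_lt_trans T'2) // -ltrBrDl.
  have -> : speed smax (v (x + (phi t - L) *: e) t) (e_ th) = G t (phi t).
    have : `|speed smax (v (x + (phi t - L) *: e) t) e - s| < s - m.
      apply: (H1 _ _ e).
      - exact: le_lt_trans hd1.
      - by rewrite ltr_norml; apply/andP; split; lra.
      - by rewrite subrr normr0.
    rewrite /G -/e; set w := speed _ _ _; rewrite ltr_norml => /andP[w1 w2].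
    by rewrite min_r ?max_r // /M; lra.
  apply: phi_der => //.
  pose line y : 'rV[R]_2 := x + (y - L) *: e.
  have line_c : {for phi t, continuous line}.
    apply/differentiable_continuous/derivable1_diffP.
    by apply: (@ex_derive _ _ _ _ _ _ (1 *: e)); apply: is_derive_along; exact: is_derive_id.
  have C1 : (fun z : R * R => line z.2) @ nbhs (t, phi t) --> line (phi t).
    exact: (cvg_comp _ _ (@cvg_snd _ _ (nbhs t) (nbhs (phi t)) (nbhs_filter _)) line_c).
  have C2 := @cvg_pair _ _ _ _ _ _ (nbhs_filter _) (nbhs_filter _) (nbhs_filter _) _ _
    C1 (@cvg_fst _ _ (nbhs t) (nbhs (phi t)) (nbhs_filter _)).
  have C3 : {for (line (phi t), t), continuous (fun z : 'rV[R]_2 * R => v z.1 z.2)}.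
    by apply: (current_continuous v_cont) => //; apply: H2; exact: le_lt_trans hd2.
  have C4 := cvg_comp _ _ C2 C3.
  have C5 := @cvg_pair _ _ _ _ _ _ (nbhs_filter _) (nbhs_filter _) (nbhs_filter _) _ _
    C4 (@cvg_cst _ e _ (nbhs (t, phi t)) (nbhs_filter _)).
  have C6 := cvg_comp _ _ C5 (@speed_continuous _ smax (v (line (phi t)) t, e)).
  have C7 : {for (t, phi t), continuous (fun z : R * R => speed smax (v (line z.2) z.1) e)}.
    exact: C6.
  apply/cvgrPdist_lt => k kpos; have /cvgrPdist_lt/(_ k kpos) := C7.
  by apply: filterS => z; apply: le_lt_trans; exact: clamp_lipschitz.
Qed.

End Extension.

(** * Optimality *)

(** A one-sided chain rule: the curve has only a left derivative at its end, that of [g], so the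
    expansions of [f] and [g] are composed by hand. *)
Lemma end_slope (R : realType) (c : curve R) e g r (f : 'rV[R]_2 -> R) :
  ends_along c e g r -> differentiable f (cpath c (clen c)) ->
  forall k : R, 0 < k -> exists2 d : R, 0 < d & forall h : R, 0 < h < d ->
    `|f (cpath c (clen c)) - f (cpath c (clen c - h))
      - h * dot (grad f (cpath c (clen c))) e| <= k * h.
Proof.
move=> [[/andP[r0 rL] e1] [gc gd] gE _ _] df k k0.
set L := clen c in rL gd gE df *; set x := cpath c L in df *; set a := grad f x.
have gx : g L = x by rewrite /x gE // lexx andbT; lra.
have C0 : 0 < 2 * `|a| + 2 by rewrite ltr_wpDl // mulr_ge0.
(* The error of [g], paired with the gradient, costs 2 |a| k' h; that of [f] costs k' times a
   displacement of at most 2 h. *)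
pose k' := Num.min 1 (k / (2 * `|a| + 2)).
have k'0 : 0 < k' by rewrite /k' lt_min ltr01 divr_gt0.
have k'1 : k' <= 1 by rewrite /k' ge_min lexx.
have k'k : k' * (2 * `|a| + 2) <= k by rewrite -ler_pdivlMr // /k' ge_min lexx orbT.
have [d1 d10 H1] := grad_eps df k'0.
have [d2 d20 H2] := is_deriveP_eps gd k'0.
exists (Num.min (d1 / 2) (Num.min d2 r)); first by rewrite !lt_min d20 r0 divr_gt0.
move=> h; rewrite !lt_min => /andP[h0 /and3P[hd1 hd2 hr]].
have -> : cpath c (L - h) = g (L - h) by apply: gE; apply/andP; split; lra.
have := H2 (- h); rewrite normrN (gtr0_norm h0) gx scaleNr opprK => /(_ hd2) rho_le.
set z := g (L - h) - x.
have zE : x + z = g (L - h) by rewrite /z addrC subrK.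
set rho := _ + h *: e in rho_le.
have zr : z = rho - h *: e by rewrite /rho addrK.
have he : `|h *: e| <= h.
  by rewrite normrZ (gtr0_norm h0) ler_piMr ?norm_unit // ltW.
have z2 : `|z| <= 2 * h.
  rewrite zr; apply: (le_trans (ler_normB _ _)).
  have : k' * h <= 1 * h by apply: ler_wpM2r => //; exact: ltW.
  lra.
have zd : `|z| < d1 by lra.
have := H1 z zd; rewrite zE -/a => F1.
have F2 : k' * `|z| <= k' * (2 * h) by apply: ler_wpM2l => //; exact: ltW.
have F3 : dot a z = dot a rho - h * dot a e by rewrite zr !dot2 !mxE; ring.
have F4 : `|dot a rho| <= 2 * `|a| * (k' * h).
  by apply: (le_trans (dot_le _ _)); apply: ler_wpM2l => //; exact: mulr_ge0.
have F5 : k' * (2 * `|a| + 2) * h <= k * h by apply: ler_wpM2r => //; exact: ltW.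
move: F1 F4; rewrite F3 !ler_norml => /andP[? ?] /andP[? ?].
by apply/andP; split; lra.
Qed.

(** * Averages over the models *)

Section Weights.
Context {R : realType} (n : nat) (p : 'I_n.+1 -> R).
Hypotheses (p_01 : forall i, 0 <= p i <= 1) (p_sum : \sum_i p i = 1).

Lemma weighted_le (F G : 'I_n.+1 -> R) : (forall i, F i <= G i) ->
  \sum_i p i * F i <= \sum_i p i * G i.
Proof.
move=> FG; apply: ler_sum => i _; apply: ler_wpM2l => //.
by have /andP[] := p_01 i.
Qed.

Lemma weighted_gt0 (F : 'I_n.+1 -> R) : (forall i, 0 < F i) -> 0 < \sum_i p i * F i.
Proof.
move=> F0; have pF i : 0 <= p i * F i.
  by rewrite mulr_ge0 ?(ltW (F0 i)) //; have /andP[] := p_01 i.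
rewrite lt0r sumr_ge0 // andbT; apply/negP => /eqP S0.
have : \sum_i p i = 0.
  apply: big1 => i _; have /eqP := psumr_eq0P (fun i _ => pF i) S0 (erefl : xpredT i).
  by rewrite mulf_eq0 (gt_eqF (F0 i)) orbF => /eqP.
by rewrite p_sum => /eqP; rewrite oner_eq0.
Qed.

Lemma weighted_lt (F G : 'I_n.+1 -> R) : (forall i, F i < G i) ->
  \sum_i p i * F i < \sum_i p i * G i.
Proof.
move=> FG; rewrite -subr_gt0 -sumrB.
rewrite (eq_bigr (fun i => p i * (G i - F i))); last by move=> i _; rewrite mulrBr.
by apply: weighted_gt0 => i; rewrite subr_gt0.
Qed.

Lemma weighted_affine (F G : 'I_n.+1 -> R) (h k : R) :
  \sum_i p i * (F i + h * (G i + k)) =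
  \sum_i p i * F i + h * (\sum_i p i * G i + k).
Proof.
rewrite [h * _]mulrDr -[h * k]mul1r -p_sum mulr_suml mulr_sumr -!big_split /=.
by apply: eq_bigr => i _; ring.
Qed.

(* A linear form that lies below a strictly convex gauge touches it on at most
   one ray. *)
Lemma touching_unique (smax : R) (w : 'I_n.+1 -> 'rV[R]_2) (a e e' : 'rV[R]_2) :
  (forall i, dot (w i) (w i) < smax ^+ 2) ->
  let S f := \sum_i p i * (speed smax (w i) f)^-1 in
  (forall f, dot f f = 1 -> dot a f <= S f) ->
  dot e e = 1 -> dot e' e' = 1 -> dot a e = S e -> dot a e' = S e' -> e = e'.
Proof.
move=> hw S aS e1 e1' ae ae'; apply/eqP; apply: contraT => ne.
have S_gt0 f : dot f f = 1 -> 0 < S f.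
  by move=> f1; apply: weighted_gt0 => i; rewrite invr_gt0 speed_gt0.
have aw : dot a (e + e') = S e + S e' by rewrite dotDr ae ae'.
(* Opposite directions are excluded: the linear form is positive on e + e', being S e + S e'
   there. *)
have w0 : 0 < dot (e + e') (e + e').
  rewrite lt0r dot_ge0 andbT; apply: contraTneq (addr_gt0 (S_gt0 _ e1) (S_gt0 _ e1')).
  by move=> /dot_eq0 E; rewrite -aw E dot2 !mxE !mulr0 addr0 ltxx.
pose c := enorm (e + e').
have c0 : 0 < c by rewrite /c sqrtr_gt0.
have cc : c * c = dot (e + e') (e + e') by rewrite -expr2 sqr_sqrtr ?ltW.
pose f := c^-1 *: (e + e').
have cf : c *: f = e + e' by rewrite /f scalerA divff ?scale1r // gt_eqF.
have f1 : dot f f = 1.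
  by rewrite /f dotZl dotZr -cc; field; rewrite gt_eqF.
have : \sum_i p i * (c / speed smax (w i) f) <
    \sum_i p i * ((speed smax (w i) e)^-1 + (speed smax (w i) e')^-1).
  by apply: weighted_lt => i; apply: inv_speed_subadd.
have -> : \sum_i p i * (c / speed smax (w i) f) = c * S f.
  by rewrite /S mulr_sumr; apply: eq_bigr => i _; ring.
have -> : \sum_i p i * ((speed smax (w i) e)^-1 + (speed smax (w i) e')^-1) = S e + S e'.
  by rewrite /S -big_split /=; apply: eq_bigr => i _; ring.
have := aS f f1; rewrite -(ler_pM2l c0) -dotZr cf aw.
by move=> h1 /(le_lt_trans h1); rewrite ltxx.
Qed.

End Weights.

Section Optimality.
Context {R : realType}.
Variables (Om : set 'rV[R]_2) (xS : 'rV[R]_2) (smax Tf : R) (n : nat)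
  (vc : 'I_n.+1 -> 'rV[R]_2 -> R -> 'rV[R]_2) (p : 'I_n.+1 -> R)
  (u : 'rV[R]_2 -> R) (gstar : 'rV[R]_2 -> curve R)
  (T : 'I_n.+1 -> 'rV[R]_2 -> R).
Hypotheses (OmxS : Om xS) (smax_gt0 : 0 < smax)
  (vc_cont : forall i,
     {within Om `*` `[0, Tf],
        continuous (fun z : 'rV[R]_2 * R => vc i z.1 z.2)})
  (vc_lt : forall i x t, Om x -> 0 <= t <= Tf -> enorm (vc i x t) < smax)
  (p_01 : forall i, 0 <= p i <= 1) (p_sum : \sum_i p i = 1)
  (u_def : minimal_mean_reachability Om xS smax Tf vc p u gstar T)
  (T_lt : forall i x, Om x -> T i x < Tf).

(** The constant curve gives [u xS = 0], which by itself says nothing about models of probability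
    zero. But some [T j xS] must vanish, so [gstar xS] has length 0, and then every model needs time
    0. *)
Lemma source_times : u xS = 0 /\ forall i, T i xS = 0.
Proof.
have [[_ umin] [_ c0 cL cOm] tt uE] := u_def OmxS.
have T0 i : 0 <= T i xS by have [s [/andP[]]] := tt i.
have Tf0 : 0 <= Tf by apply: le_trans (T0 0) (ltW (T_lt 0 OmxS)).
have u0 : u xS <= 0.
  apply: umin; exists (Curve 0 (cst xS)), (fun=> 0); split.
  - split => //; exists 0%N, (fun=> 0); split => //.
  - move=> i; exists (fun=> 0); split => //; first by rewrite lexx.
    + by apply: continuous_subspaceT; exact: cst_continuous.
    + exists [::] => t /andP[t1 t2]; exfalso.
      by have := lt_trans t1 t2; rewrite ltxx.
  - by rewrite /mean_time big1 // => i _; rewrite mulr0.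
have ux : u xS = 0.
  apply/eqP; rewrite eq_le u0 uE /mean_time sumr_ge0 // => i _.
  by rewrite mulr_ge0 //; have /andP[] := p_01 i.
split=> //; have [j Tj] : exists j, T j xS = 0.
  apply: contrapT => /forallNP nT.
  have : 0 < u xS.
    rewrite uE; apply: weighted_gt0 => // i.
    by rewrite lt0r T0 andbT; apply/eqP/nT.
  by rewrite ux ltxx.
have L0 : clen (gstar xS) = 0.
  by have [s [_ [s0 sT] _ _ _]] := tt j; rewrite -sT Tj.
move=> i; have [s mot] := tt i.
by apply: (motion_T_eq0 smax_gt0 (vc_lt i) _ mot) => // t; rewrite L0.
Qed.

Variable x : 'rV[R]_2.
Hypotheses (x_int : interior Om x) (x_neq : x != xS) (du : differentiable u x).

(** The mean slowness: expected time per unit length when leaving x in direction e, each model i at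
    its own time [T i x]. *)
Let S (e : 'rV[R]_2) := \sum_i p i * (speed smax (vc i x (T i x)) e)^-1.

Lemma x_Om : Om x. Proof. exact: nbhs_singleton. Qed.

Lemma gstar_end : cpath (gstar x) (clen (gstar x)) = x.
Proof. by have [_ []] := u_def x_Om. Qed.

Lemma gstar_Om (s : R) : 0 <= s <= clen (gstar x) -> Om (cpath (gstar x) s).
Proof. by have [_ [_ _ _ h] _ _] := u_def x_Om; apply: h. Qed.

Lemma gstar_len : 0 < clen (gstar x).
Proof.
have [_ [_ c0 cL _] tt _] := u_def x_Om; have [s mot] := tt 0.
have [/andP[T0 _] _ _ _ _] := mot.
have /andP[h0 hL] := motion_range mot (introT andP (conj (lexx 0) T0)).
rewrite lt0r (le_trans h0 hL) andbT; apply: contraNneq x_neq => L0.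
by rewrite -cL -c0 L0.
Qed.

Lemma T_gt0 i : 0 < T i x.
Proof.
have [_ _ tt _] := u_def x_Om; have [s mot] := tt i.
exact: motion_T_gt0 mot gstar_len.
Qed.

(** The prolonged curve competes for [u] at x + h e, so that u(x + h e) <= u(x) + h (S e + k); the
    expansion of [u] at x, with error k h, leaves the slack eps = 2 k. *)
Lemma grad_le (th : R) : dot (grad u x) (e_ th) <= S (e_ th).
Proof.
apply/ler_addgt0Pl => eps eps0; pose k := eps / 2.
have k0 : 0 < k by rewrite divr_gt0.
have [_ conn tt uE] := u_def x_Om.
have Hd i : exists d : R, 0 < d /\ forall h : R, 0 < h < d ->
    exists2 T', travel_time smax Tf (vc i) (extend (gstar x) (e_ th) h) T'
      & T' <= T i x + h * ((speed smax (vc i x (T i x)) (e_ th))^-1 + k).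
  have [s mot] := tt i.
  have xI : interior Om (cpath (gstar x) (clen (gstar x))) by rewrite gstar_end.
  have [d d0 Hd] := extend_travel_time smax_gt0 (@vc_cont i) (vc_lt i) gstar_Om mot
    (T_gt0 i) (T_lt i x_Om) xI th k0.
  by exists d; split => //; move: Hd; rewrite gstar_end.
have [d Hd'] := choice Hd.
have [r r0 Hr] := grad_eps du k0.
have [b b0 Hb] : exists2 b : R, 0 < b & forall z, `|z - x| < b -> Om z.
  case/nbhs_ballP: x_int => b /= b0 Hb; exists b => // z zx; apply: Hb.
  by rewrite -ball_normE /ball_ /= distrC.
have [h [h0 hr hb hd]] : exists h : R, [/\ 0 < h, h < r, h < b & forall i, h < d i].
  (* The models are finitely many, so one h suits them all. *)
  have N : \forall h \near (0 : R)^'+, forall i, h < d i.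
    by apply: filter_forall => i; apply: nbhs_right_lt; exact: (Hd' i).1.
  have [h [[h1 h2] [h3 h4]]] := filter_ex (filterI
    (filterI (nbhs_right_gt (0 : R)) (nbhs_right_lt r0)) (filterI (nbhs_right_lt b0) N)).
  by exists h.
have HT i := (Hd' i).2 h (introT andP (conj h0 (hd i))).
have HT' i : exists T', travel_time smax Tf (vc i) (extend (gstar x) (e_ th) h) T'
      /\ T' <= T i x + h * ((speed smax (vc i x (T i x)) (e_ th))^-1 + k).
  by have [T' ? ?] := HT i; exists T'.
have [T' HT''] := choice HT'.
have e1 := e_unit th.
have hen : `|h *: e_ th| <= h.
  by rewrite normrZ (gtr0_norm h0) ler_piMr ?norm_unit // ltW.
have zOm : Om (x + h *: e_ th).
  by apply: Hb; rewrite addrAC subrr add0r; apply: le_lt_trans hb.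
have U1 : u (x + h *: e_ th) <= u x + h * (S (e_ th) + k).
  have [[_ umin] _ _ _] := u_def zOm.
  apply: (@le_trans _ _ (mean_time p T')).
    apply: umin; exists (extend (gstar x) (e_ th) h), T'; split => //.
    - apply: extend_connects => // z zx; apply: Hb; exact: le_lt_trans hb.
    - by move=> i; exact: (HT'' i).1.
  rewrite uE /mean_time -weighted_affine //.
  by apply: weighted_le => // i; exact: (HT'' i).2.
have := Hr (h *: e_ th) (le_lt_trans hen hr).
rewrite dotZr ler_norml => /andP[U2 _].
have U3 : k * `|h *: e_ th| <= k * h by apply: ler_wpM2l => //; exact: ltW.
have kE : eps = k + k by rewrite /k; lra.
rewrite -(ler_pM2l h0) kE !mulrDr; lra.
Qed.

Variables (e : 'rV[R]_2) (g : R -> 'rV[R]_2) (r : R).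
Hypothesis gstar_ends : ends_along (gstar x) e g r.

(** [arrival_rate] indexed by the distance h to the end instead of the time: all models can then be
    compared at the same point of the curve. *)
Lemma passing_times i sigma : motion smax Tf (vc i) (gstar x) (T i x) sigma ->
  forall k : R, 0 < k -> exists2 d : R, 0 < d & forall h : R, 0 < h < d ->
    exists t, [/\ 0 <= t <= T i x, sigma t = clen (gstar x) - h &
      `|T i x - t - h / speed smax (vc i x (T i x)) e| <= k * h].
Proof.
move=> mot k k0.
have xI : interior Om (cpath (gstar x) (clen (gstar x))) by rewrite gstar_end.
have [d d0 Hd] := arrival_rate smax_gt0 (@vc_cont i) (vc_lt i) gstar_Om mot
  (T_gt0 i) (T_lt i x_Om) xI gstar_ends k0.
have L0 := gstar_len.
exists (Num.min d (clen (gstar x))); first by rewrite lt_min d0.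
move=> h; rewrite lt_min => /and3P[h0 hd hL].
have [t tT st] : exists2 t, 0 <= t <= T i x & sigma t = clen (gstar x) - h.
  by apply: (motion_reaches mot); apply/andP; split; lra.
exists t; split => //; have := Hd t tT; rewrite st opprB addrC subrK gstar_end.
exact.
Qed.

Lemma grad_ge : S e <= dot (grad u x) e.
Proof.
apply/ler_addgt0Pl => eps eps0; pose k := eps / 2.
have k0 : 0 < k by rewrite divr_gt0.
have [_ conn tt uE] := u_def x_Om.
have [sigma mot] := choice tt.
have Hd i : exists d : R, 0 < d /\ forall h : R, 0 < h < d ->
    exists t, [/\ 0 <= t <= T i x, sigma i t = clen (gstar x) - h &
      `|T i x - t - h / speed smax (vc i x (T i x)) e| <= k * h].
  by have [d d0 Hd] := passing_times (mot i) k0; exists d.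
have [d Hd'] := choice Hd.
have du' : differentiable u (cpath (gstar x) (clen (gstar x))) by rewrite gstar_end.
have [r1 r10 Hr] := end_slope gstar_ends du' k0; rewrite gstar_end in Hr.
have [[/andP[r0 rL] _] _ _ pw _] := gstar_ends.
have [h [h0 hr hb hd]] : exists h : R, [/\ 0 < h, h < r1, h < r & forall i, h < d i].
  have N : \forall h \near (0 : R)^'+, forall i, h < d i.
    by apply: filter_forall => i; apply: nbhs_right_lt; exact: (Hd' i).1.
  have [h [[h1 h2] [h3 h4]]] := filter_ex (filterI
    (filterI (nbhs_right_gt (0 : R)) (nbhs_right_lt r10)) (filterI (nbhs_right_lt r0) N)).
  by exists h.
have [t Ht] := choice (fun i => (Hd' i).2 h (introT andP (conj h0 (hd i)))).
set l := clen (gstar x) - h in Ht.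
have l0 : 0 <= l <= clen (gstar x) by rewrite /l; apply/andP; split; lra.
(* The truncated curve with its passing times is a competitor at this earlier point, while [u x] is
   exactly the mean of the full times; the decrease of [u] over h is thus at least h (S e - k). *)
have U1 : u (cpath (gstar x) l) <= u x - h * (S e - k).
  have [[_ umin] _ _ _] := u_def (gstar_Om l0).
  apply: (@le_trans _ _ (mean_time p t)).
    apply: umin; exists (Curve l (cpath (gstar x))), t; split => //.
    - have [_ c0 _ cOm] := conn; split => //=.
      + by apply: pw; rewrite /l; apply/andP; split; lra.
      + move=> s /andP[s0 sl]; apply: cOm; rewrite s0 (le_trans sl) //.
        by case/andP: l0.
    - move=> i; have [t1 t2 _] := Ht i; exists (sigma i); rewrite -t2.
      exact: (motion_trunc (mot i) t1).
  rewrite uE /mean_time -mulNr -weighted_affine //.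
  apply: weighted_le => // i; have [_ _] := Ht i; rewrite ler_norml => /andP[t1 t2].
  lra.
have := Hr h (introT andP (conj h0 hr)); rewrite -/l ler_norml => /andP[_ U2].
have kE : eps = k + k by rewrite /k; lra.
rewrite -(ler_pM2l h0) kE !mulrDr; lra.
Qed.

(** The time T_i(x) - t spent on the last length h is estimated twice: by [passing_times] it is h
    over the speed, and by [end_slope] it is h times the slope of [T i], because agreement makes t
    the value of [T i] at the point passed. *)
Lemma grad_T_end i : times_agree_along smax Tf vc gstar T x -> differentiable (T i) x ->
  dot (grad (T i) x) e = (speed smax (vc i x (T i x)) e)^-1.
Proof.
move=> agree dT; have [sigma [mot ag]] := agree i.
set N := _^-1; set D := dot _ _.
suff : `|D - N| <= 0 by rewrite normr_le0 subr_eq0 => /eqP.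
apply/ler_addgt0Pl => eps eps0; rewrite addr0; pose k := eps / 2.
have k0 : 0 < k by rewrite divr_gt0.
have [d1 d10 H1] := passing_times mot k0.
have dT' : differentiable (T i) (cpath (gstar x) (clen (gstar x))) by rewrite gstar_end.
have [d2 d20 H2] := end_slope gstar_ends dT' k0; rewrite gstar_end in H2.
pose h := Num.min d1 d2 / 2.
have hm : 0 < Num.min d1 d2 by rewrite lt_min d10.
have h0 : 0 < h by rewrite divr_gt0.
have : h < Num.min d1 d2 by rewrite /h; lra.
rewrite lt_min => /andP[h1 h2].
have [t [tT st]] := H1 h (introT andP (conj h0 h1)); rewrite -/N => E1.
have := H2 h (introT andP (conj h0 h2)); rewrite -st ag // -/D => E2.
have kE : eps = k + k by rewrite /k; lra.
rewrite -(ler_pM2r h0) kE -[in leLHS](gtr0_norm h0) -normrM.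
move: E1 E2; rewrite !ler_norml => /andP[? ?] /andP[? ?].
by apply/andP; split; lra.
Qed.

End Optimality.

Theorem proposition1 (R : realType)
  (Om : set 'rV[R]_2) (xS : 'rV[R]_2) (smax Tf : R) (n : nat)
  (vc : 'I_n.+1 -> 'rV[R]_2 -> R -> 'rV[R]_2) (p : 'I_n.+1 -> R)
  (u : 'rV[R]_2 -> R) (gstar : 'rV[R]_2 -> curve R)
  (T : 'I_n.+1 -> 'rV[R]_2 -> R)
  (OmxS : Om xS) (smax_gt0 : 0 < smax)
  (vc_cont : forall i,
     {within Om `*` `[0, Tf],
        continuous (fun z : 'rV[R]_2 * R => vc i z.1 z.2)})
  (vc_lt : forall i x t, Om x -> 0 <= t <= Tf -> enorm (vc i x t) < smax)
  (p_01 : forall i, 0 <= p i <= 1) (p_sum : \sum_i p i = 1)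
  (u_def : minimal_mean_reachability Om xS smax Tf vc p u gstar T)
  (T_lt : forall i x, Om x -> T i x < Tf)
  (u_cont : {within Om, continuous u})
  (u_smooth : smooth_on (interior Om `\ xS) u)
  (T_cont : forall i, {within Om, continuous (T i)})
  (T_smooth : forall i, smooth_on (interior Om `\ xS) (T i)) :
  (forall x, interior Om x -> x != xS ->
     is_min (hamiltonian smax vc p u T x @` `[0, 2 * pi[) 0 /\
     (times_agree_along smax Tf vc gstar T x ->
      forall theta,
        is_minimizer `[0, 2 * pi[ (hamiltonian smax vc p u T x) theta ->
        forall i,
          dot (grad (T i) x)
              (s_max smax (vc i) theta x (T i x) *: e_ theta) = 1)) /\
  u xS = 0 /\ (forall i, T i xS = 0).
Proof.
split; last exact: source_times u_def T_lt.
move=> x x_int x_neq.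
have xD : (interior Om `\ xS) x by split => //; exact/eqP.
have du : differentiable u x by have [h _] := u_smooth 1%N; apply: h.
have xOm : Om x by exact: nbhs_singleton.
have [_ [pw _ _ _] tt _] := u_def x xOm.
have len := gstar_len u_def x_int x_neq.
have [e [g [r ends]]] := end_direction pw len.
have [[_ e1] _ _ _ _] := ends.
have [th0 th0I eE] := unit_e e1.
have T0 i : 0 <= T i x <= Tf.
  by rewrite (ltW (T_lt i x xOm)) andbT; have [s [/andP[]]] := tt i.
have wlt i : dot (vc i x (T i x)) (vc i x (T i x)) < smax ^+ 2.
  exact: (dot_current_lt smax_gt0 (vc_lt i)).
pose S f := \sum_i p i * (speed smax (vc i x (T i x)) f)^-1.
have sp i th : 0 < speed smax (vc i x (T i x)) (e_ th).
  by apply: speed_gt0 => //; exact: e_unit.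
have HE th : hamiltonian smax vc p u T x th =
    speed smax (vc ord0 x (T ord0 x)) (e_ th) * (S (e_ th) - dot (grad u x) (e_ th)).
  rewrite /hamiltonian dotZr mulrBr addrC s_maxE; congr (_ - _).
  by rewrite /S mulr_sumr; apply: eq_bigr => i _; rewrite !s_maxE; ring.
have le_S th : dot (grad u x) (e_ th) <= S (e_ th).
  exact: (grad_le smax_gt0 vc_cont vc_lt p_01 p_sum u_def T_lt x_int x_neq du).
have ge_S : S e <= dot (grad u x) e.
  exact: (grad_ge smax_gt0 vc_cont vc_lt p_01 p_sum u_def T_lt x_int x_neq du ends).
have H_ge0 th : 0 <= hamiltonian smax vc p u T x th.
  by rewrite HE mulr_ge0 ?subr_ge0 // ltW.
have H0 : hamiltonian smax vc p u T x th0 = 0.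
  by apply/eqP; rewrite eq_le H_ge0 andbT HE pmulr_rle0 // subr_le0 -eE.
split.
  split; first by exists th0.
  by move=> _ [th _ <-].
move=> agree th [thI thmin] i.
(* A minimizer cannot exceed the value 0 at [th0]; its direction therefore also touches S and must
   coincide with e. *)
have Hth : hamiltonian smax vc p u T x th = 0.
  by apply/eqP; rewrite eq_le H_ge0 andbT -H0 thmin.
have Eth : dot (grad u x) (e_ th) = S (e_ th).
  by move/eqP: Hth; rewrite HE mulf_eq0 gt_eqF //= subr_eq0 => /eqP.
have Ee : dot (grad u x) e = S e.
  by apply/eqP; rewrite eq_le ge_S andbT [in leLHS]eE [in leRHS]eE.
have eth : e_ th = e.
  apply: (touching_unique p_01 p_sum wlt _ (e_unit th) e1 Eth Ee) => f /unit_e[th' _ ->].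
  exact: le_S.
have dT : differentiable (T i) x by have [h _] := T_smooth i 1%N; apply: h.
rewrite dotZr s_maxE eth.
rewrite (grad_T_end smax_gt0 vc_cont vc_lt u_def T_lt x_int x_neq ends agree dT).
by rewrite mulfV // gt_eqF // -eth.
Qed.
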